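(* Let $\alpha$ be a non-zero algebraic number. Then $M_1(\alpha)\in K_\alpha$.
   Context: Fix an embedding $\overline{\mathbb{Q}}\subseteq\mathbb{C}$, so that $K_\alpha$, the Galois closure of $\mathbb{Q}(\alpha)$ over $\mathbb{Q}$, is a subfield of $\mathbb{C}$. For a number field $F$ and a place $v$ of $F$ over the place $p$ of $\mathbb{Q}$, let $\|\cdot\|_v$ extend the usual absolute value of $\mathbb{Q}_p$ to $F_v$ and set $|x|_v=\|x\|_v^{[F_v:\mathbb{Q}_p]/[F:\mathbb{Q}]}$. The Weil height is $H(x)=\prod_v\max\{1,|x|_v\}$ over all places of $F$ (independent of $F$), and the Mahler measure is $M(x)=H(x)^{[\mathbb{Q}(x):\mathbb{Q}]}$. The metric Mahler measure is $M_1(\alpha)=\inf\{\prod_{n=1}^N M(\alpha_n): N\in\mathbb{N},\ \alpha_n\in\overline{\mathbb{Q}}^\times,\ \alpha=\prod_{n=1}^N\alpha_n\}$. *)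

(* Defs.v *)
From HB Require Import structures.
From mathcomp Require Import all_boot all_order all_algebra all_field.
From mathcomp Require Import boolp classical_sets functions fsbigop.
From mathcomp Require Import reals exp.
From mathcomp Require Import complex.

Set Implicit Arguments.
Unset Strict Implicit.
Unset Printing Implicit Defensive.

Import Order.TTheory GRing.Theory Num.Theory.
Local Open Scope classical_set_scope.
Local Open Scope ring_scope.

Section Places.
Variable R : realType.

(* |q|_p = p ^ (ord_p (denominator) - ord_p (numerator)) *)
Definition padic_abs (p : nat) (q : rat) : R :=
  if q == 0 then 0
  else p%:R ^ ((logn p `|denq q|%N)%:Z - (logn p `|numq q|%N)%:Z).

Definition archi_abs (q : rat) : R := `|ratr q|.

Variable F : fieldExtType rat.
Implicit Types (v : F -> R) (u : nat -> F).

Definition absolute_value v : Prop :=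
  [/\ forall x, 0 <= v x,
      forall x, (v x = 0) <-> (x = 0),
      {morph v : x y / x * y >-> x * y}
    & forall x y, v (x + y) <= v x + v y].

(* A place of F over the place p of Q is represented by its unique member
   extending the usual absolute value of Q_p. *)
Definition place_over v (w : rat -> R) : Prop :=
  absolute_value v /\ forall q : rat, v q%:A = w q.

Definition places : set (F -> R) :=
  [set v | place_over v archi_abs \/
           exists2 p, prime p & place_over v (padic_abs p)].

Definition cauchy_seq v u : Prop :=
  forall e : R, 0 < e ->
    exists N, forall m n, (N <= m)%N -> (N <= n)%N -> v (u m - u n) < e.

Definition null_seq v u : Prop :=
  forall e : R, 0 < e -> exists N, forall n, (N <= n)%N -> v (u n) < e.

(* Elements of F_v are Cauchy sequences of F modulo null sequences, and the
   elements of Q_p inside F_v are the classes of Cauchy sequences of rationals.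
   [qcomb c b] represents the linear combination \sum_i c_i b_i in F_v. *)
Definition qcauchy v (c : nat -> rat) : Prop := cauchy_seq v (fun n => (c n)%:A).

Definition qcomb (d : nat) (c : 'I_d -> nat -> rat) (b : 'I_d -> nat -> F) :
  nat -> F := fun n => \sum_(i < d) c i n *: b i n.

(* The classes of b_0, ..., b_(d-1) form a basis of F_v over Q_p. *)
Definition completion_basis v (d : nat) (b : 'I_d -> nat -> F) : Prop :=
  [/\ forall i, cauchy_seq v (b i),
      forall u, cauchy_seq v u ->
        exists2 c : 'I_d -> nat -> rat,
          forall i, qcauchy v (c i) & null_seq v (u \- qcomb c b)
    & forall c : 'I_d -> nat -> rat, (forall i, qcauchy v (c i)) ->
        null_seq v (qcomb c b) -> forall i, null_seq v (fun n => (c i n)%:A)].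

(* [F_v : Q_p] *)
Definition local_degree v : nat :=
  xget 0%N [set d | exists b : 'I_d -> nat -> F, completion_basis v b].

Definition normalized_abs v (x : F) : R :=
  v x `^ ((local_degree v)%:R / (\dim {:F})%:R).

(* Only finitely many factors differ from 1. *)
Definition height_in (x : F) : R :=
  \big[*%R/1]_(v \in places) Num.max 1 (normalized_abs v x).

End Places.

(* Q(x) as an abstract number field, with its generator mapping to x under the
   embedding into algC that [num_field_exists] provides. *)
Definition Qadj (x : algC) : fieldExtType rat := tag (num_field_exists [:: x]).

Definition Qadj_gen (x : algC) : Qadj x :=
  head 0 (s2val (tagged (tagged (num_field_exists [:: x])))).

Section Mahler.
Variable R : realType.

(* The height does not depend on the number field containing x. *)
Definition weil_height (x : algC) : R := height_in R (Qadj_gen x).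

Definition mahler (x : algC) : R := weil_height x ^+ \dim {:Qadj x}.

Definition metric_mahler (x : algC) : R :=
  inf [set y : R | exists N (a : 'I_N -> algC),
        [/\ (0 < N)%N, forall n, a n != 0, x = \prod_(n < N) a n
          & y = \prod_(n < N) mahler (a n)]].

End Mahler.

Definition normal_subfield (K : {pred algC}) : Prop :=
  divring_closed K /\
  forall x y, x \in K -> root (minCpoly x) y -> y \in K.

(* The smallest subfield of algC that contains x and is normal over Q. *)
Definition galois_closure (x : algC) : set algC :=
  [set z | forall K : {pred algC}, normal_subfield K -> x \in K -> z \in K].

(* Main.v *)
Require Import Defs.
From HB Require Import structures.
From mathcomp Require Import all_boot all_order all_fingroup all_algebra all_field.
From mathcomp Require Import boolp classical_sets fsbigop.
From mathcomp Require Import reals exp complex.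
From mathcomp Require Import ring lra zify.

Set Implicit Arguments.
Unset Strict Implicit.
Unset Printing Implicit Defensive.

Import Order.TTheory GRing.Theory Num.Theory.
Local Open Scope ring_scope.

(** Let H be the group of automorphisms of algC fixing all conjugates of alpha; its
    fixed field is K_alpha. In a factorization alpha = prod a_n, replace each a_n by
    an e_n-th root g_n of the product of its H-orbit (of size e_n): M(g_n) <= M(a_n),
    and averaging over H shows that alpha / prod g_n is a root of unity. Some power of
    g_n lies in K_alpha, so an element of H changes conjugates of g_n by roots of
    unity only; hence M(g_n), which up to sign is the leading coefficient times the
    conjugates outside the unit disc, is an algebraic integer of K_alpha, and it
    bounds all its own conjugates. Such numbers are closed under products and only
    finitely many of them lie below a given bound, so the infimum is attained by one
    of them.

    The formula for M in terms of conjugates comes from the places of F = Q(x) as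
    follows. Fix an absolute value w on algC over each place of Q (for a prime p, from
    a maximal subring of algC not containing 1/p). Weak approximation shows that every
    place of F over it is w o s for an embedding s of F, and that its local degree is
    the number of such s; the finite places then contribute the leading coefficient
    by Gauss's lemma. *)

(** * Absolute values on a field *)

(** Northcott's finiteness cannot be applied to the factors $a_n$, since neither their degrees nor
    their number is bounded. Only the degree of $K_\alpha$ is bounded, so finiteness is sought for
    the values of the products and not for the factorizations. This asks for a property of the real
    number $M(g_n)$ that survives multiplication, which [dominant_value] provides. The radicals
    $g_n$ themselves may lie outside $K_\alpha$. The $e_n$-th root compensates for the different
    orbit lengths, which would otherwise turn $\alpha$ into a product with unequal exponents; its
    price is a root of unity, which has measure at most 1 and can be inserted as one more factor.

    On the side of places, the local degree speaks only of Cauchy sequences in $F$. Accordingly no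
    completion is constructed: weak approximation does the work of the extension theory of complete
    fields, and the closure of $\mathbb{Q}$ inside [algC] under $w$ stands for $\mathbb{Q}_p$. *)

Section AbsoluteValues.
Variables (R : realType) (K : fieldType).
Implicit Types (v : K -> R) (x y : K).

Definition absval v : Prop :=
  [/\ forall x, 0 <= v x,
      forall x, (v x = 0) <-> (x = 0),
      {morph v : x y / x * y >-> x * y}
    & forall x y, v (x + y) <= v x + v y].

Variable v : K -> R.
Hypothesis av : absval v.

Lemma av_ge0 x : 0 <= v x. Proof. by case: av. Qed.

Lemma av_eq0 x : (v x == 0) = (x == 0).
Proof. by case: av => _ e _ _; apply/eqP/eqP => /e. Qed.

Lemma avM x y : v (x * y) = v x * v y. Proof. by case: av. Qed.

Lemma avD x y : v (x + y) <= v x + v y. Proof. by case: av. Qed.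

Lemma av0 : v 0 = 0. Proof. by apply/eqP; rewrite av_eq0. Qed.

Lemma av_gt0 x : (0 < v x) = (x != 0).
Proof. by rewrite lt_neqAle av_ge0 andbT eq_sym av_eq0. Qed.

Lemma av1 : v 1 = 1.
Proof.
apply: (@mulfI _ (v 1)); first by rewrite av_eq0 oner_eq0.
by rewrite -avM !mulr1.
Qed.

Lemma avX x n : v (x ^+ n) = v x ^+ n.
Proof. by elim: n => [|n IH]; rewrite ?av1 // !exprS avM IH. Qed.

Lemma avN x : v (- x) = v x.
Proof.
have e : v (-1) = 1.
  apply/eqP; rewrite -(@eqrXn2 _ 2) ?av_ge0 //.
  by rewrite -avX sqrrN expr1n av1 expr1n.
by rewrite -mulN1r avM e mul1r.
Qed.

Lemma avV x : v x^-1 = (v x)^-1.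
Proof.
have [->|x0] := eqVneq x 0; first by rewrite invr0 av0 invr0.
apply: (@mulfI _ (v x)); first by rewrite av_eq0.
by rewrite -avM !mulfV ?av_eq0 // av1.
Qed.

Lemma av_div x y : v (x / y) = v x / v y.
Proof. by rewrite avM avV. Qed.

Lemma av_prod (I : Type) (s : seq I) (P : pred I) (F : I -> K) :
  v (\prod_(i <- s | P i) F i) = \prod_(i <- s | P i) v (F i).
Proof. exact: (big_morph v avM av1). Qed.

Lemma av_sum (I : Type) (s : seq I) (P : pred I) (F : I -> K) :
  v (\sum_(i <- s | P i) F i) <= \sum_(i <- s | P i) v (F i).
Proof.
elim/big_rec2: _ => [|i y x _ le]; first by rewrite av0.
by apply: le_trans (avD _ _) _; rewrite lerD2l.
Qed.

Lemma avB x y : v (x - y) <= v x + v y.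
Proof. by rewrite -(avN y) avD. Qed.

Lemma av_distC x y : v (x - y) = v (y - x).
Proof. by rewrite -avN opprB. Qed.

Lemma avB_le x y : v x - v y <= v (x - y).
Proof. by rewrite lerBlDr -{1}(subrK y x) avD. Qed.

End AbsoluteValues.

Lemma absval_comp (R : realType) (K L : fieldType) (f : {rmorphism K -> L})
  (v : L -> R) : absval v -> absval (v \o f).
Proof.
move=> av; split=> /= [x|x|x y|x y]; rewrite ?rmorphM ?rmorphD.
- exact: (av_ge0 av).
- split=> [/eqP|->]; last by rewrite rmorph0 av0.
  by rewrite av_eq0 // fmorph_eq0 => /eqP.
- by rewrite /= rmorphM (avM av).
- exact: (avD av).
Qed.

(** * Growth and decay of powers *)

Section Bernoulli.
Variable R : archiRealFieldType.

Lemma bernoulli (r : R) n : 0 <= r -> 1 + r *+ n <= (1 + r) ^+ n.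
Proof.
move=> r0; elim: n => [|n IH]; first by rewrite mulr0n addr0.
rewrite exprS mulrDl mul1r mulrS addrCA.
rewrite [leLHS]addrC lerD //.
by rewrite ler_peMr // (le_trans _ IH) // lerDl mulrn_wge0.
Qed.

Lemma expr_unbounded (x B : R) : 1 < x -> exists N, forall n, (N <= n)%N -> B < x ^+ n.
Proof.
move=> x1; have r0 : 0 < x - 1 by rewrite subr_gt0.
exists (Num.bound (B / (x - 1))) => n le_n.
have -> : x = 1 + (x - 1) by ring.
apply: lt_le_trans (bernoulli _ (ltW r0)).
rewrite -ltrBlDl.
have : B / (x - 1) < n%:R.
  have [B0|B0] := lerP 0 (B / (x - 1)).
    by apply: lt_le_trans (archi_boundP B0) _; rewrite ler_nat.
  exact: lt_le_trans B0 (ler0n _ _).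
rewrite ltr_pdivrMr // mulr_natl => lt.
by apply: lt_trans lt; rewrite ltrBlDl ltrDr.
Qed.

End Bernoulli.

Lemma expr_small (R : archiRealFieldType) (x e : R) : 0 <= x < 1 -> 0 < e ->
  exists N, forall n, (N <= n)%N -> x ^+ n < e.
Proof.
move=> /andP[x0 x1] e0; have [->|xn0] := eqVneq x 0.
  by exists 1%N => -[|n] // _; rewrite expr0n.
have xp : 0 < x by rewrite lt_neqAle eq_sym xn0.
have [|N HN] := @expr_unbounded R x^-1 e^-1; first by rewrite invf_gt1.
by exists N => n /HN; rewrite exprVn ltf_pV2 ?posrE ?exprn_gt0.
Qed.

(** * Weak approximation *)

Section WeakApproximation.
Variables (R : realType) (K : fieldType).
Implicit Types (v : K -> R).

(** On a logarithmic scale with unit [- ln (v1 t)], if [v1 y < v2 y] then some rational $m/k$ lies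
    strictly between the two sizes of [y], and $y^k t^m$ is in the open unit ball of [v1] but not in
    that of [v2]. *)
Lemma av_leq_of_balls v1 v2 (t : K) : absval v1 -> absval v2 ->
  0 < v1 t < 1 -> v2 t = v1 t -> (forall y, v1 y < 1 -> v2 y < 1) ->
  forall y, v2 y <= v1 y.
Proof.
move=> a1 a2 /andP[t0 t1] t12 sub y.
have [->|y0] := eqVneq y 0; first by rewrite !av0.
rewrite leNgt; apply/negP => lt12.
have p1 : 0 < v1 y by rewrite av_gt0.
have p2 : 0 < v2 y by rewrite av_gt0.
have tn0 : t != 0 by rewrite -(av_gt0 a1).
set c := v1 t in t0 t1 t12.
have lc : 0 < - ln c by rewrite oppr_gt0 ln_lt0 ?t0.
pose a := ln (v1 y) / - ln c; pose b := ln (v2 y) / - ln c.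
have ab : a < b by rewrite ltr_pM2r ?invr_gt0 // ltr_ln.
have [q] := rat_in_itvoo ab; rewrite in_itv /= => /andP[aq qb].
pose k := `|denq q|%N.
have kE : k%:R = (denq q)%:~R :> R by rewrite -[in RHS]absz_denq.
have k0 : 0 < k%:R :> R by rewrite kE ltr0z denq_gt0.
have qE : ratr q = (numq q)%:~R / k%:R :> R by rewrite kE.
move: aq qb; rewrite qE ltr_pdivlMr // ltr_pdivrMr // /a /b.
rewrite ![_ / _ * _]mulrAC ltr_pdivrMr // ltr_pdivlMr // => h1 h2.
have key v : absval v -> v t = c -> 
   (v (y ^+ k * t ^ (numq q)) < 1) = (ln (v y) * k%:R < (numq q)%:~R * - ln c).
  move=> av vt.
  have vtz m : v (t ^ m) = c ^ m.
    case: m => m; first by rewrite -!exprnP avX // vt.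
    by rewrite NegzE -!exprnN avV // avX // vt.
  have vy : 0 < v y by rewrite av_gt0.
  have cz : 0 < c ^ numq q by rewrite exprz_gt0.
  rewrite avM // avX // vtz -[LHS](@ltr_ln _ _ _) ?posrE ?mulr_gt0 ?exprn_gt0 //.
  rewrite ln1 lnM ?posrE ?exprn_gt0 // lnXn // -mulr_natr.
  have -> : ln (c ^ numq q) = (numq q)%:~R * ln c.
    case: (numq q) => m; first by rewrite -exprnP lnXn // mulr_natl.
    rewrite NegzE -exprnN lnV ?posrE ?exprn_gt0 // lnXn //.
    by rewrite intrN mulNr mulr_natl.
  by rewrite mulrN -ltrBrDr sub0r mul1r mulr_natr.
have /sub : v1 (y ^+ k * t ^ (numq q)) < 1 by rewrite key.
by rewrite key //; lra.
Qed.

(** Agreement at one element of size strictly between 0 and 1 excludes trivial absolute values and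
    distinct powers of the same one, so that different absolute values are inequivalent. For places,
    [t] is a rational number. *)
Definition same_base (t : K) v1 v2 := [/\ absval v1, absval v2, 0 < v1 t < 1 & v2 t = v1 t].

Lemma same_base_sym t v1 v2 : same_base t v1 v2 -> same_base t v2 v1.
Proof. by case=> a1 a2 h e; split=> //; rewrite e. Qed.

Lemma av_eq_of_balls t v1 v2 : same_base t v1 v2 ->
  (forall y, v1 y < 1 -> v2 y < 1) -> v1 = v2.
Proof.
move=> [a1 a2 t01 t12] sub; apply/funext => y.
apply/eqP; rewrite eq_le (av_leq_of_balls a1 a2 t01) // andbT.
have [->|y0] := eqVneq y 0; first by rewrite !av0.
have := av_leq_of_balls a1 a2 t01 t12 sub y^-1.
by rewrite !avV // lef_pV2 ?posrE ?av_gt0.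
Qed.

(** Neither open unit ball contains the other; the quotient of an element of one difference by an
    element of the other separates. *)
Lemma av_separate t v1 v2 : same_base t v1 v2 -> v1 <> v2 ->
  exists y, v1 y > 1 /\ v2 y < 1.
Proof.
have aux w1 w2 : same_base t w1 w2 -> w1 <> w2 -> exists y, w1 y < 1 /\ 1 <= w2 y.
  move=> sb ne; apply: contrapT => /forallNP H; apply: ne.
  apply: av_eq_of_balls sb _ => y y1; rewrite ltNge; apply/negP => y2.
  exact: (H y).
move=> sb ne; have [a1 a2 _ _] := sb.
have [x [x1 x2]] := aux _ _ sb ne.
have [y [y2 y1]] := aux _ _ (same_base_sym sb) (nesym ne).
have y0 : 0 < v1 y by apply: lt_le_trans y1.
have [xe0|x0] := eqVneq x 0; first by move: x2; rewrite xe0 av0 // ler10.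
exists (y / x); rewrite !av_div // ltr_pdivlMr ?av_gt0 // mul1r.
rewrite ltr_pdivrMr ?av_gt0 // mul1r; split; first exact: lt_le_trans y1.
exact: lt_le_trans x2.
Qed.

(** The soft step of Artin and Whaples: $y^n/(1+y^n)$ sorts absolute values by whether [y] is larger
    or smaller than 1 there. *)
Lemma av_ratio_to1 v y (e : R) : absval v -> 1 < v y -> 0 < e ->
  exists N, forall n, (N <= n)%N -> v (y ^+ n / (1 + y ^+ n) - 1) < e.
Proof.
move=> av y1 e0.
have [N HN] := expr_unbounded (1 + e^-1) y1.
exists N => n /HN lt.
have vn : e^-1 < v (1 + y ^+ n).
  have := avB_le av (y ^+ n) (- 1); rewrite (avN av) (av1 av) avX // opprK addrC [_ + 1]addrC.
  by move/(lt_le_trans _); apply; rewrite addrC ltrBrDl.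
have n0 : 1 + y ^+ n != 0.
  by rewrite -(av_gt0 av) (lt_trans _ vn) // invr_gt0.
rewrite -[X in _ - X](divff n0) -mulrBl opprD addrCA subrr addr0.
by rewrite av_div // (avN av) (av1 av) mul1r -[e]invrK ltf_pV2 ?posrE ?invr_gt0 // av_gt0.
Qed.

Lemma av_ratio_to0 v y (e : R) : absval v -> v y < 1 -> 0 < e ->
  exists N, forall n, (N <= n)%N -> v (y ^+ n / (1 + y ^+ n)) < e.
Proof.
move=> av y1 e0; pose d := Num.min (2^-1) (e / 2).
have d0 : 0 < d by rewrite lt_min invr_gt0 ltr0n divr_gt0.
have [|N HN] := @expr_small R (v y) d _ d0; first by rewrite av_ge0.
exists N => n /HN; rewrite lt_min => /andP[lt1 lt2].
have vn : 2^-1 < v (1 + y ^+ n).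
  have := avB_le av 1 (- y ^+ n); rewrite (avN av) (av1 av) avX // opprK.
  by move/(lt_le_trans _); apply; lra.
have p : 0 < v (1 + y ^+ n) by apply: lt_trans vn; rewrite invr_gt0.
rewrite av_div // ltr_pdivrMr // avX // (lt_trans lt2) //.
by rewrite ltr_pM2l.
Qed.

(** Induction on [vs]: [y] serves the tail, [z] separates [v] from the head [u], and [z] is
    multiplied by a power of [y], or by a soft step in [y] when [y] is large at [u]. The alternative
    [vs = [::]] is there because a trivial [v] takes no value above 1. *)
Lemma av_separate_seq t v (vs : seq (K -> R)) :
  absval v -> (forall v', v' \in vs -> same_base t v v' /\ v <> v') ->
  exists y, (vs = [::] \/ 1 < v y) /\ forall v', v' \in vs -> v' y < 1.
Proof.
move=> av; elim: vs => [|u vs IH] H; first by exists 0; split=> //; left.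
have [|y [y1 ys]] := IH; first by move=> v' h; apply: H; rewrite inE h orbT.
have [sbu neu] := H u (mem_head _ _); have [_ au _ _] := sbu.
have [z [z1 zu]] := av_separate sbu neu.
case: y1 => [vs0|y1].
  by exists z; split=> [|v']; [right|rewrite vs0 inE => /eqP->].
have avs v' : v' \in vs -> absval v'.
  by move=> h; have [|[]//] := H v'; rewrite inE h orbT.
have unif (f : nat -> K) : (forall v', v' \in vs -> forall e, 0 < e ->
     exists N, forall n, (N <= n)%N -> v' (f n) < e) ->
   forall e, 0 < e -> exists N, forall n, (N <= n)%N -> forall v', v' \in vs -> v' (f n) < e.
  move=> Hf e e0; elim: (vs) Hf => [|u' us IHu] Hf; first by exists 0%N.
  have [|N1 H1] := IHu; first by move=> v' h; apply: Hf; rewrite inE h orbT.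
  have [|N2 H2] := Hf u' _ e e0; first by rewrite mem_head.
  exists (maxn N1 N2) => n; rewrite geq_max => /andP[n1 n2] v'.
  by rewrite inE => /orP[/eqP->|h]; [apply: H2|apply: H1].
have [yu|yu] := lerP (u y) 1.
  have [|N HN] := unif (fun n => z * y ^+ n) _ 1 ltr01.
    move=> v' h e e0; have a' := avs _ h.
    have [||N HN] := @expr_small R (v' y) (e / (1 + v' z)).
    - by rewrite av_ge0 // ys.
    - by rewrite divr_gt0 // ltr_pwDl // av_ge0.
    exists N => n /HN; rewrite ltr_pdivlMr; last by rewrite ltr_pwDl // av_ge0.
    rewrite avM // avX // => lt; apply: le_lt_trans lt.
    by rewrite mulrC ler_wpM2l ?exprn_ge0 ?av_ge0 // lerDr.
  exists (z * y ^+ N); split=> [|v'].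
    right; rewrite avM // avX //; apply: lt_le_trans z1 _.
    by rewrite ler_peMr ?av_ge0 // exprn_ege1 // ltW.
  rewrite inE => /orP[/eqP->|h]; last exact: HN.
  rewrite avM // avX //; apply: le_lt_trans zu.
  by rewrite ler_piMr ?av_ge0 // exprn_ile1 ?av_ge0.
(* At [v] and [u], where [y] is large, [f n] tends to [z]; on the tail it tends to 0. *)
pose f n := z * (y ^+ n / (1 + y ^+ n)).
have near v' e : absval v' -> 1 < v' y -> 0 < e ->
    exists N, forall n, (N <= n)%N -> v' (f n - z) < e.
  move=> a' y1' e0.
  have p : 0 < 1 + v' z by rewrite ltr_pwDl // av_ge0.
  have [|N HN] := @av_ratio_to1 v' y (e / (1 + v' z)) a' y1'.
    by rewrite divr_gt0.
  exists N => n /HN; rewrite ltr_pdivlMr // => lt; apply: le_lt_trans lt.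
  rewrite /f -[X in _ - X]mulr1 -mulrBr avM // mulrC.
  by rewrite ler_wpM2l ?av_ge0 // lerDr.
have [N1 H1] := near v (v z - 1) av y1 ltac:(by rewrite subr_gt0).
have [N2 H2] := near u (1 - u z) au yu ltac:(by rewrite subr_gt0).
have [|N3 H3] := unif f _ 1 ltr01.
  move=> v' h e e0; have a' := avs _ h.
  have p : 0 < 1 + v' z by rewrite ltr_pwDl // av_ge0.
  have [|N HN] := @av_ratio_to0 v' y (e / (1 + v' z)) a' (ys _ h).
    by rewrite divr_gt0.
  exists N => n /HN; rewrite ltr_pdivlMr // => lt; apply: le_lt_trans lt.
  by rewrite /f avM // mulrC ler_wpM2l ?av_ge0 // lerDr.
pose N := (N1 + N2 + N3)%N.
have /H1 h1 : (N1 <= N)%N by rewrite /N -addnA leq_addr.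
have /H2 h2 : (N2 <= N)%N by rewrite /N addnAC leq_addl.
have /H3 h3 : (N3 <= N)%N by rewrite /N leq_addl.
exists (f N); split=> [|v'].
  right; have := avB_le av z (f N); rewrite av_distC // => le.
  by have := lt_le_trans h1 (lexx _); lra.
rewrite inE => /orP[/eqP->|]; last exact: h3.
have := avB_le au (f N) z => le; lra.
Qed.

Lemma weak_approximation t v (vs : seq (K -> R)) (e : R) :
  absval v -> (forall v', v' \in vs -> same_base t v v' /\ v <> v') -> 0 < e ->
  exists y, v (y - 1) < e /\ forall v', v' \in vs -> v' y < e.
Proof.
move=> av H e0; have [y [[vs0|y1] ys]] := av_separate_seq av H.
  by exists 1; split=> [|v']; rewrite ?subrr ?av0 // vs0.
have [N1 H1] := av_ratio_to1 av y1 e0.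
have [N2 H2] : exists N, forall n, (N <= n)%N -> forall v', v' \in vs ->
    v' (y ^+ n / (1 + y ^+ n)) < e.
  elim: (vs) H ys => [|u us IH] H ys; first by exists 0%N.
  have [v' h|v' h|N2 H2] := IH; try by [apply: H; rewrite inE h orbT|apply: ys; rewrite inE h orbT].
  have [[_ au _ _] _] := H u (mem_head _ _).
  have [N3 H3] := av_ratio_to0 au (ys u (mem_head _ _)) e0.
  exists (maxn N2 N3) => n; rewrite geq_max => /andP[n1 n2] v'.
  by rewrite inE => /orP[/eqP->|h]; [apply: H3|apply: H2].
exists (y ^+ (maxn N1 N2) / (1 + y ^+ (maxn N1 N2))).
by split=> [|v' h]; [apply: H1|apply: H2] => //; rewrite ?leq_maxl ?leq_maxr.
Qed.

End WeakApproximation.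

(** * Conjugates and automorphisms of algC *)

Notation pQtoC := (map_poly (ratr : rat -> algC)).
Notation pZtoQ := (map_poly (intr : int -> rat)).
Notation pZtoC := (map_poly (intr : int -> algC)).

Definition conjs (x : algC) : seq algC :=
  sval (closed_field_poly_normal (minCpoly x)).

Lemma minCpoly_conjs x : minCpoly x = \prod_(z <- conjs x) ('X - z%:P).
Proof.
rewrite /conjs; case: closed_field_poly_normal => s /= {1}->.
by rewrite (monicP (minCpoly_monic x)) scale1r.
Qed.

Lemma mem_conjs x z : (z \in conjs x) = root (minCpoly x) z.
Proof. by rewrite minCpoly_conjs root_prod_XsubC. Qed.

Lemma conjs_id x : x \in conjs x.
Proof. by rewrite mem_conjs root_minCpoly. Qed.

Lemma mem_conjs_aut (nu : {rmorphism algC -> algC}) x z :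
  (nu z \in conjs x) = (z \in conjs x).
Proof.
rewrite !mem_conjs; have [p [-> _] _] := minCpolyP x.
rewrite -[in RHS](fmorph_root nu) -map_poly_comp.
by congr (root _ _); apply: eq_map_poly => a /=; rewrite fmorph_rat.
Qed.

Lemma size_conjs x : size (minCpoly x) = (size (conjs x)).+1.
Proof. by rewrite minCpoly_conjs size_prod_XsubC. Qed.

Lemma irreducible_minCpoly (x : algC) (p : {poly rat}) : minCpoly x = pQtoC p ->
  irreducible_poly p.
Proof.
move=> Dp; have [q [Dq mq] dq] := minCpolyP x.
have <- : q = p by apply: (map_poly_inj (ratr : {rmorphism rat -> algC})); rewrite -Dp.
have rq : root (pQtoC q) x by rewrite dq.
have nzq := monic_neq0 mq.
by apply/(subfx_irreducibleP rq nzq) => r r0 nzr; rewrite dvdp_leq // -dq.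
Qed.

Lemma conjs_uniq x : uniq (conjs x).
Proof.
rewrite -separable_prod_XsubC -minCpoly_conjs.
have [p [Dp mp] _] := minCpolyP x.
rewrite Dp separable_map unlock.
rewrite (irreducible_poly_coprime _ (irreducible_minCpoly Dp)).
apply/negP => /(dvdp_leq _).
have sp : (1 < size p)%N by rewrite -(size_map_poly (ratr : {rmorphism rat -> algC})) -Dp size_minCpoly.
have d0 : p^`() != 0.
  apply/eqP => /polyP/(_ (size p).-2); rewrite coef_deriv coef0.
  have -> : (size p).-2.+1 = (size p).-1 by case: (size p) sp => [|[]].
  rewrite -/(lead_coef p) (monicP mp) => /eqP.
  by rewrite mulrn_eq0 oner_eq0; case: (size p) sp => [|[]].
move/(_ d0); rewrite leqNgt lt_size_deriv //; exact: monic_neq0.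
Qed.

Lemma map_conjs_aut (nu : {rmorphism algC -> algC}) x :
  perm_eq (map nu (conjs x)) (conjs x).
Proof.
have u : uniq (map nu (conjs x)) by rewrite map_inj_uniq ?conjs_uniq //; exact: fmorph_inj.
apply: uniq_perm => //; first exact: conjs_uniq.
have sub : {subset map nu (conjs x) <= conjs x}.
  by move=> _ /mapP[z zx ->]; rewrite mem_conjs_aut.
by have [] := uniq_min_size u sub; rewrite ?size_map.
Qed.

(** Adjoining all conjugates gives the splitting field of a rational polynomial. Questions about
    automorphisms of [algC] are settled in [L] by Galois theory and carried back by
    [extend_algC_subfield_aut]. *)
Lemma normal_num_field (s : seq algC) :
  exists (L : splittingFieldType rat) (LC : {rmorphism L -> algC}),
    (forall K : {subfield L}, galois K {:L}) /\
    forall x, x \in s -> exists y, LC y = x.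
Proof.
have [Q [QC [s1 Ds1 gen1]]] := num_field_exists (flatten (map conjs s)).
have ax : SplittingField.axiom Q.
  pose P : {poly Q} := \prod_(y <- s1) ('X - y%:P).
  have DP : map_poly QC P = \prod_(x <- s) minCpoly x.
    rewrite map_prod_XsubC -(big_map QC xpredT (fun z => 'X - z%:P)) Ds1 big_flatten big_map.
    by apply: eq_bigr => x _; rewrite minCpoly_conjs.
  have [r Dr] : exists r, map_poly QC P = pQtoC r.
    rewrite DP; elim: (s) => [|x s' [r IH]]; first by exists 1; rewrite big_nil rmorph1.
    have [p [Dp _] _] := minCpolyP x.
    by exists (p * r); rewrite big_cons rmorphM /= IH Dp.
  have DPr : P = map_poly (in_alg Q) r.
    apply: (map_poly_inj QC); rewrite Dr -map_poly_comp.
    by apply: eq_map_poly => a /=; rewrite rmorphZ_num rmorph1 mulr1.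
  exists P.
    rewrite DPr; apply/polyOverP => i; rewrite coef_map /=; exact: rpredZ (mem1v _).
  exists s1 => //; exact: eqpxx.
pose axM := FieldExt_isSplittingField.Build rat Q ax.
pose L : splittingFieldType rat := HB.pack Q axM.
exists L, QC; split=> [K|x xs].
  rewrite /galois subvf normalFieldf andbT /=.
  apply/separableP => y _; apply: pcharf0_separable.
  by move=> p; rewrite -(fmorph_pchar QC) pchar_num.
have : x \in flatten (map conjs s).
  by apply/flattenP; exists (conjs x); [apply: map_f|apply: conjs_id].
by rewrite -Ds1 => /mapP[y _ ->]; exists y.
Qed.

Lemma conj_autP x z :
  z \in conjs x -> exists nu : {rmorphism algC -> algC}, nu x = z.
Proof.
move=> zx; have [L [LC [gal im]]] := normal_num_field [:: x; z].
have [x0 Dx] := im x (mem_head _ _).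
have [z0 Dz] : exists y, LC y = z by apply: im; rewrite !inE eqxx orbT.
have rt : root (minPoly 1 x0) z0.
  rewrite -(fmorph_root LC) Dz.
  have /polyOver1P[q Dq] := minPolyOver 1 x0.
  have Dq' : map_poly LC (minPoly 1 x0) = pQtoC q.
    rewrite Dq -map_poly_comp.
    by apply: eq_map_poly => a /=; rewrite rmorphZ_num rmorph1 mulr1.
  have : root (pQtoC q) x by rewrite -Dq' -Dx fmorph_root root_minPoly.
  rewrite Dq'; move: zx; rewrite mem_conjs; have [p [-> _] ->] := minCpolyP x.
  by move=> pz /dvdpP[r ->]; rewrite rmorphM rootM pz orbT.
have [g _ gx] := normalField_root_minPoly (subvf 1) (normalFieldf 1) (memvf x0) rt.
have [nu Dnu] := extend_algC_subfield_aut LC g.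
by exists nu; rewrite -Dx -Dnu /= gx.
Qed.

Lemma Crat_fixed z :
  (forall nu : {rmorphism algC -> algC}, nu z = z) -> z \in Crat.
Proof.
move=> fz; have /all_pred1P cE : all (pred1 z) (conjs z).
  by apply/allP => y /conj_autP[nu /= <-]; rewrite fz.
have [p [Dp _] _] := minCpolyP z.
have := minCpoly_conjs z; rewrite cE big_nseq.
have : (size (conjs z) <= 1)%N.
  have := conjs_uniq z; rewrite cE size_nseq.
  by case: (size _) => [|[|n]] //=; rewrite mem_head.
have := conjs_id z; case: (size _) cE => [->|[|//]] // _ _ _ /=.
rewrite mulr1 Dp => /polyP/(_ 0); rewrite coef_map /= coefB coefX coefC.
by rewrite sub0r => h; rewrite -rpredN -h Crat_rat.
Qed.

(** By the Galois correspondence in a finite normal extension, [z] lies in the field generated by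
    [cs]. This is the passage from a fixed field to membership in every subfield, as
    [galois_closure] requires. *)
Lemma fixed_mem_divring (cs : seq algC) z :
  (forall nu : {rmorphism algC -> algC},
     (forall c, c \in cs -> nu c = c) -> nu z = z) ->
  forall K : {pred algC}, divring_closed K -> {subset cs <= K} -> z \in K.
Proof.
move=> fz K dK csK; have [L [LC [gal im]]] := normal_num_field (z :: cs).
have [z0 Dz] := im z (mem_head _ _).
have [cs1 Dcs] : exists cs1, map LC cs1 = cs.
  have : forall x, x \in cs -> exists y, LC y = x.
    by move=> x h; apply: im; rewrite inE h orbT.
  elim: (cs) => [|c s IH] h; first by exists [::].
  have [|s1 <-] := IH; first by move=> x xs; apply: h; rewrite inE xs orbT.
  by have [c1 <-] := h c (mem_head _ _); exists (c1 :: s1).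
have z0K : z0 \in <<(1%AS : {subfield L}) & cs1>>%VS.
  have /galois_fixedField <- := gal <<1 & cs1>>%AS.
  apply/fixedFieldP; first exact: memvf.
  move=> g Gg; have [nu Dnu] := extend_algC_subfield_aut LC g.
  apply: (fmorph_inj LC); rewrite Dnu Dz; apply: fz => c; rewrite -Dcs => /mapP[c1 c1s ->].
  by rewrite -Dnu /= (fixed_gal (subvf _) Gg) //; apply: seqv_sub_adjoin.
pose KM := GRing.isDivringClosed.Build algC K dK.
pose K' : divringClosed algC := HB.pack K KM.
have csK' y : y \in cs1 -> LC y \in K' by move=> h; apply: csK; rewrite -Dcs map_f.
rewrite -Dz -[K]/(K' : {pred algC}).
have : forall y, y \in (1%AS : {subfield L}) -> LC y \in K'.
  by move=> y /vlineP[a ->]; rewrite rmorphZ_num rmorph1 mulr1 rpred_rat.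
elim: (cs1) (1%AS) csK' z0K => [|c s IH] U csK' /=.
  by rewrite adjoin_nil subfield_closed => zU UK; apply: UK.
rewrite adjoin_cons => zU UK; apply: (IH <<U; c>>%AS) => //.
  by move=> y ys; apply: csK'; rewrite inE ys orbT.
move=> y /Fadjoin_polyP[p pU ->]; rewrite -horner_map rpred_horner //.
  by apply/polyOverP => i; rewrite coef_map /= UK // (polyOverP pU).
by apply: csK'; rewrite mem_head.
Qed.

(** * Extension of the p-adic absolute value to algC *)

Definition is_subring (K : nzRingType) (A : set K) : Prop :=
  [/\ A 1, forall x y, A x -> A y -> A (x - y) & forall x y, A x -> A y -> A (x * y)].

Section SubringTheory.
Variables (K : nzRingType) (A : set K).
Hypothesis sA : is_subring A.

Lemma subr_1 : A 1. Proof. by case: sA. Qed.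
Lemma subr_B x y : A x -> A y -> A (x - y). Proof. by case: sA => _ h _; apply: h. Qed.
Lemma subr_M x y : A x -> A y -> A (x * y). Proof. by case: sA => _ _; apply. Qed.
Lemma subr_0 : A 0. Proof. by rewrite -(subrr 1); apply: subr_B; exact: subr_1. Qed.
Lemma subr_N x : A x -> A (- x).
Proof. by move=> ax; rewrite -sub0r; apply: subr_B => //; exact: subr_0. Qed.
Lemma subr_D x y : A x -> A y -> A (x + y).
Proof. by move=> ax ay; rewrite -[y]opprK; apply: subr_B => //; exact: subr_N. Qed.
Lemma subr_X x n : A x -> A (x ^+ n).
Proof.
move=> ax; elim: n => [|n IH]; first exact: subr_1.
by rewrite exprS; apply: subr_M.
Qed.
Lemma subr_nat n : A n%:R.
Proof.
elim: n => [|n IH]; first exact: subr_0.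
by rewrite mulrS; apply: subr_D => //; exact: subr_1.
Qed.
Lemma subr_sum (I : Type) (s : seq I) (P : pred I) (F : I -> K) :
  (forall i, P i -> A (F i)) -> A (\sum_(i <- s | P i) F i).
Proof.
move=> h; elim/big_rec: _ => [|i y Pi ay]; first exact: subr_0.
by apply: subr_D => //; exact: h.
Qed.
End SubringTheory.

(** * Subrings maximal among those avoiding $1/t$ are valuation rings *)

Section MaximalSubring.
Variables (K : fieldType) (t : K).
Hypotheses (t0 : t != 0).
Implicit Types (A B : set K).

Definition maximal_avoiding A : Prop :=
  [/\ is_subring A, ~ A t^-1 &
      forall B, is_subring B -> (forall x, A x -> B x) -> ~ B t^-1 ->
        forall x, B x -> A x].

Lemma maximal_avoiding_exists (A0 : set K) : is_subring A0 -> ~ A0 t^-1 ->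
  exists A, maximal_avoiding A.
Proof.
move=> sA0 nA0; pose P A := (A = set0 \/ is_subring A) /\ ~ A t^-1.
have [F FP totF|A [[sA nA] maxA]] := @Zorn_bigcup K P.
  split; last by move=> [X FX] /(proj2 (FP _ FX)).
  have [[X [FX sX]]|noX] := pselect (exists X, F X /\ is_subring X); last first.
    left; apply/seteqP; split=> // x [X FX Xx]; case: (FP _ FX) => -[X0|sX] _.
      by move: Xx; rewrite X0.
    by case: noX; exists X.
  right; have both x y : (\bigcup_(X in F) X)%classic x -> (\bigcup_(X in F) X)%classic y ->
      exists Y, [/\ F Y, is_subring Y, Y x & Y y].
    move=> [Y FY Yx] [Z FZ Zy].
    have nz W w : F W -> W w -> is_subring W.
      by move=> FW Ww; case: (FP _ FW) => -[W0|//] _; move: Ww; rewrite W0.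
    case: (totF _ _ FY FZ) => [YZ|ZY].
      by exists Z; split => //; [apply: nz FZ Zy|apply: YZ].
    by exists Y; split => //; [apply: nz FY Yx|apply: ZY].
  split; first by exists X => //; exact: subr_1.
    by move=> x y /both h /h [Y [FY sY Yx Yy]]; exists Y => //; exact: subr_B.
  by move=> x y /both h /h [Y [FY sY Yx Yy]]; exists Y => //; exact: subr_M.
case: sA => [A0E|sA].
  case: (maxA A0); last by split; [right|].
  rewrite A0E; split; first exact: sub0set.
  by move/(_ 1 (subr_1 sA0)).
exists A; split=> // B sB AB nB x Bx; apply: contrapT => nAx.
apply: (maxA B); last by split; [right|].
by split=> // /(_ x Bx).
Qed.

Variable A : set K.
Hypothesis mA : maximal_avoiding A.
Let sA : is_subring A := let: And3 h _ _ := mA in h.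
Let nA : ~ A t^-1 := let: And3 _ h _ := mA in h.
Hypothesis At : A t.

(** By maximality it is enough that the localization of [A] at $u = 1 - tb$ still avoids $1/t$. If
    $1/t = a/u^k$, then $u^k = ta$, while $u^k = 1 - tc$ with $c$ in [A]; hence $1/t = a + c$ is in
    [A]. *)
Lemma one_sub_unit b : A b -> A (1 - t * b)^-1.
Proof.
move=> Ab; set u := 1 - t * b.
have Au : A u by apply: subr_B => //; [exact: subr_1|exact: subr_M].
have [u0|u0] := eqVneq u 0; first by rewrite u0 invr0; exact: subr_0.
pose B : set K := fun x => exists a k, A a /\ x = a / u ^+ k.
case: mA => _ _ maxA; apply: (maxA B); last by exists 1, 1%N; split; [exact: subr_1|rewrite expr1 mul1r].
- split; first by exists 1, 0%N; rewrite divr1; split=> //; exact: subr_1.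
  + move=> _ _ [a [k [Aa ->]]] [a' [k' [Aa' ->]]].
    exists (a * u ^+ k' - a' * u ^+ k), (k + k')%N; split.
      by apply: subr_B => //; apply: subr_M => //; apply: subr_X.
    by rewrite exprD; field; rewrite !expf_neq0.
  + move=> _ _ [a [k [Aa ->]]] [a' [k' [Aa' ->]]].
    exists (a * a'), (k + k')%N; split; first exact: subr_M.
    by rewrite exprD; field; rewrite !expf_neq0.
- by move=> x Ax; exists x, 0%N; rewrite divr1.
move=> [a [k [Aa e]]].
have [c Ac uk] : exists2 c, A c & u ^+ k = 1 - t * c.
  elim: (k) => [|n [c Ac IH]]; first by exists 0; [exact: subr_0|rewrite mulr0 subr0].
  exists (b * u ^+ n + c); first by apply: subr_D => //; apply: subr_M => //; apply: subr_X.
  by rewrite exprS {1}/u mulrBl mul1r {1}IH; ring.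
apply: nA; suff -> : t^-1 = a + c by exact: subr_D.
have h : u ^+ k = t * a.
  apply: (@mulfI _ t^-1); first by rewrite invr_eq0.
  by rewrite mulKf // e divfK // expf_neq0.
apply: (@mulfI _ t) => //; rewrite mulfV // mulrDr -h uk; ring.
Qed.

Let Apoly (P : {poly K}) := forall i : nat, A P`_i.

(** The relation for [Q] reads $u = t\sum_{j \ge 1} Q_j x^{-j}$ with $u = 1 - tQ_0$ a unit.
    Multiplied by $x^n$, where $n$ is the degree of [P], it expresses $x^n$ through lower powers of
    $x$, and this removes the leading term of [P]. *)
Lemma reduce_inverse_poly x (P Q : {poly K}) : x != 0 -> Apoly P -> Apoly Q ->
  (size Q <= size P)%N -> t * P.[x] = 1 -> t * Q.[x^-1] = 1 ->
  exists2 P', Apoly P' & (size P' < size P)%N /\ t * P'.[x] = 1.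
Proof.
move=> x0 AP AQ sQP eP eQ.
have P0 : P != 0 by apply: contra_eq_neq eP => ->; rewrite horner0 mulr0 eq_sym oner_eq0.
have [n sP] : exists n, size P = n.+1 by exists (size P).-1; rewrite prednK // lt0n size_poly_eq0.
have Au := one_sub_unit (AQ 0%N).
set u := 1 - t * Q`_0 in Au.
have hQ : u = t * \sum_(j < n) Q`_j.+1 * x ^- j.+1.
  rewrite /u -eQ (@horner_coef_wide _ n.+1) ?(leq_trans sQP) ?sP // big_ord_recl.
  rewrite expr0 mulr1 mulrDr addrAC subrr add0r; congr (_ * _).
  by apply: eq_bigr => j _; rewrite exprVn.
have [u0|u0] := eqVneq u 0.
  case: nA; suff -> : t^-1 = Q`_0 by exact: AQ.
  apply: (@mulfI _ t) => //; rewrite mulfV //; apply/eqP; rewrite -subr_eq0; apply/eqP.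
  exact: u0.
pose P' := \poly_(i < n) (P`_i + t * P`_n * (Q`_(n - i) * u^-1)).
exists P'.
  move=> i; rewrite coef_poly; case: ifP => _; last exact: subr_0.
  apply: subr_D => //; apply: subr_M; first by [].
    exact: subr_M.
  exact: subr_M.
split; first by rewrite sP ltnS size_poly.
rewrite -eP (@horner_coef_wide _ n) ?size_poly // horner_coef sP big_ord_recr /=.
congr (_ * _).
under eq_bigr => i _ do rewrite coef_poly ltn_ord mulrDl.
rewrite big_split /=; congr (_ + _).
have -> : x ^+ n = u^-1 * (t * \sum_(j < n) Q`_j.+1 * x ^- j.+1) * x ^+ n.
  by rewrite -hQ mulVf // mul1r.
rewrite !mulr_sumr mulr_suml mulr_sumr (reindex_inj rev_ord_inj) /=; apply: eq_bigr => j _.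
have jn : (n - (n - j.+1) = j.+1)%N by rewrite subKn.
rewrite jn; have -> : x ^+ n = x ^+ (n - j.+1) * x ^+ j.+1 by rewrite -exprD subnK.
have : x ^+ j.+1 != 0 by rewrite expf_neq0.
move: (x ^+ j.+1) (x ^+ (n - j.+1)) => X Y X0; by field; rewrite X0 u0.
Qed.

(** Otherwise, by maximality, both $A[x]$ and $A[1/x]$ contain $1/t$. The two relations then shorten
    each other forever, the longer one being reduced each time. *)
Lemma maximal_avoiding_valuation x : x != 0 -> A x \/ A x^-1.
Proof.
move=> x0.
have adj y : ~ A y -> exists2 P, Apoly P & t * P.[y] = 1.
  move=> nAy; apply: contrapT => noP; apply: nAy.
  pose B : set K := fun z => exists2 P, Apoly P & z = P.[y].
  case: mA => _ _ maxA; apply: (maxA B).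
  - split.
    + exists 1; last by rewrite hornerC.
      by move=> i; rewrite coef1; exact: subr_nat.
    + move=> _ _ [P AP ->] [Q AQ ->]; exists (P - Q); last by rewrite hornerD hornerN.
      by move=> i; rewrite coefB; exact: subr_B.
    + move=> _ _ [P AP ->] [Q AQ ->]; exists (P * Q); last by rewrite hornerM.
      by move=> i; rewrite coefM; apply: subr_sum => // j _; exact: subr_M.
  - move=> z Az; exists z%:P; last by rewrite hornerC.
    by move=> i; rewrite coefC; case: ifP => // _; exact: subr_0.
  - by move=> [P AP e]; apply: noP; exists P; rewrite // -e mulfV.
  - by exists 'X; rewrite ?hornerX // => i; rewrite coefX; exact: subr_nat.
apply: contrapT => /not_orP[/adj[P AP eP] /adj[Q AQ eQ]].
have [N] := ubnP (size P + size Q); elim: N x P Q x0 AP eP AQ eQ => // N IH x P Q x0 AP eP AQ eQ lt.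
have [le|le] := leqP (size Q) (size P).
  have [P' AP' [lt' eP']] := reduce_inverse_poly x0 AP AQ le eP eQ.
  by apply: (IH x P' Q) => //; lia.
have [||Q' AQ' [lt' eQ']] := @reduce_inverse_poly x^-1 Q P _ AQ AP (ltnW le) eQ.
- by rewrite invr_eq0.
- by rewrite invrK.
by apply: (IH x P Q') => //; lia.
Qed.

End MaximalSubring.

Definition ultrametric (R : realType) (K : fieldType) (w : K -> R) : Prop :=
  forall x y, w (x + y) <= Num.max (w x) (w y).

(** * The absolute value of a maximal subring of [algC] avoiding $1/p$ *)

Section PadicExtension.
Variables (R : realType) (p : nat).
Hypothesis pp : prime p.

Let pC : algC := p%:R.
Let pC0 : pC != 0. Proof. by rewrite pnatr_eq0 -lt0n prime_gt0. Qed.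

Lemma padic_subring_exists : exists A : set algC, maximal_avoiding pC A.
Proof.
apply: (@maximal_avoiding_exists _ _ (fun x => exists z : int, x = z%:~R)).
  split; first by exists 1.
  - by move=> _ _ [x ->] [y ->]; exists (x - y); rewrite rmorphB.
  - by move=> _ _ [x ->] [y ->]; exists (x * y); rewrite rmorphM.
move=> [z /(congr1 ( *%R pC))]; rewrite mulfV // => e.
have : (1 : int) = p%:Z * z.
  by apply: (@intr_inj algC); rewrite rmorph1 rmorphM; exact: e.
move/(congr1 absz); rewrite abszM /= => /esym/eqP; rewrite muln_eq1.
by case/andP => /eqP p1; move: pp; rewrite p1.
Qed.

Let A : set algC := sval (cid padic_subring_exists).
Let mA : maximal_avoiding pC A := svalP (cid padic_subring_exists).
Let sA : is_subring A. Proof. by case: mA. Qed.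
Let nA : ~ A pC^-1. Proof. by case: mA. Qed.
Let Ap : A pC. Proof. exact: subr_nat. Qed.
Let valA x : x != 0 -> A x \/ A x^-1.
Proof. exact: maximal_avoiding_valuation mA Ap x. Qed.

Let U (u : algC) := A u /\ A u^-1.

Let U_V u : U u -> U u^-1. Proof. by case=> a b; split=> //; rewrite invrK. Qed.
Let U_M u u' : U u -> U u' -> U (u * u').
Proof. by move=> [a b] [c d]; split; rewrite ?invfM; exact: subr_M. Qed.
Let U_X u n : U u -> U (u ^+ n).
Proof. by move=> [a b]; split; rewrite -?exprVn; exact: subr_X. Qed.
(** Bezout gives $-am = 1 - kp$, which is invertible in [A] by [one_sub_unit]. *)
Let U_coprime (m : nat) : coprime p m -> U m%:R.
Proof.
move=> co; split; first exact: subr_nat.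
have [a _] := Bezoutl m (prime_gt0 pp); rewrite (eqP co) => /dvdnP[k e].
have m0 : (m%:R : algC) != 0.
  rewrite pnatr_eq0; apply/eqP => m0; move: co; rewrite m0 /coprime gcdn0.
  by move/eqP => p1; move: pp; rewrite p1.
have eC : 1 + a%:R * m%:R = k%:R * pC :> algC.
  by rewrite -natrM -[1]/(1%:R) -natrD e natrM.
have -> : m%:R^-1 = - a%:R * (1 - pC * k%:R)^-1 :> algC.
  have h : 1 - pC * k%:R = - a%:R * m%:R by rewrite mulrC -eC; ring.
  rewrite h; have [a0|a0] := eqVneq (a%:R : algC) 0; last by field; rewrite a0 m0.
  exfalso; apply: nA; suff -> : pC^-1 = k%:R by exact: subr_nat.
  by apply: (@mulfI _ pC) => //; rewrite mulfV // mulrC -eC a0 mul0r addr0.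
apply: subr_M => //; first by apply: subr_N => //; exact: subr_nat.
by apply: one_sub_unit => //; exact: subr_nat.
Qed.

Let U_int (z : int) : z != 0 -> U (z%:~R / pC ^+ logn p `|z|).
Proof.
move=> z0; have z1 : (0 < `|z|)%N by rewrite absz_gt0.
have [m co e] := pfactor_coprime pp z1.
have -> : z%:~R / pC ^+ logn p `|z| = (-1) ^+ (z < 0)%R * m%:R.
  rewrite {1}[z]intEsign rmorphMsign /= -pmulrn {1}e natrM natrX.
  by rewrite -mulrA mulfK // expf_neq0.
apply: U_M; last exact: U_coprime.
by case: (z < 0)%R; rewrite ?expr1 ?expr0; split; rewrite ?invrN ?invr1; 
   try apply: subr_N => //; exact: subr_1.
Qed.

Let pz_notA (j : int) : (0 < j)%R -> ~ A (pC ^ (- j)).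
Proof.
case: j => // -[//|n] _ h; apply: nA.
have -> : pC^-1 = pC ^ (- n.+1%:Z) * pC ^+ n.
  by rewrite -exprnN exprS invfM mulfVK // expf_neq0.
by apply: subr_M => //; exact: subr_X.
Qed.

(** This says that $|y| = p^{j/N}$: the value group is a group of rational powers of $p$, and a real
    exponent avoids choosing roots of $p$ in [algC]. *)
Let has_val (y : algC) (N : nat) (j : int) := (0 < N)%N /\ U (y ^+ N * pC ^ j).

(** The non-units of a valuation ring form an ideal. The case [S = 0] stands apart because the
    inverse of 0 is 0, which is in [A]. *)
Let nonunit_sum (I : eqType) (s : seq I) (F : I -> algC) :
  (forall i, i \in s -> A (F i) /\ ~ A (F i)^-1) ->
  let S := \sum_(i <- s) F i in A S /\ (S = 0 \/ ~ A S^-1).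
Proof.
move=> H /=; elim: s H => [|i s IH] H; first by rewrite big_nil; split; [exact: subr_0|left].
rewrite big_cons; have [Ai nAi] := H i (mem_head _ _).
have [|AS nAS] := IH; first by move=> j js; apply: H; rewrite inE js orbT.
set S := \sum_(j <- s) F j in AS nAS *.
split; first exact: subr_D.
have [->|S0] := eqVneq S 0; first by right; rewrite addr0.
have {}nAS : ~ A S^-1 by case: nAS => // e; rewrite e eqxx in S0.
have [->|T0] := eqVneq (F i + S) 0; [by left|right].
have F0 : F i != 0 by apply/eqP => e; apply: nAi; rewrite e invr0; exact: subr_0.
have [|h|h] := @valA (S / F i); first by rewrite mulf_neq0 ?invr_eq0.
  move=> hT; apply: nAi.
  have -> : (F i)^-1 = (F i + S)^-1 * (1 + S / F i) by field; rewrite T0 F0.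
  by apply: subr_M => //; apply: subr_D => //; exact: subr_1.
move=> hT; apply: nAS.
have -> : S^-1 = (F i + S)^-1 * (1 + (S / F i)^-1) by field; rewrite S0 T0 F0.
by apply: subr_M => //; apply: subr_D => //; exact: subr_1.
Qed.

Let max_term (s : seq algC) : s != [::] -> (forall x, x \in s -> x != 0) ->
  exists2 m, m \in s & forall x, x \in s -> A (x / m).
Proof.
elim: s => // x s IH _ H; have [s0|s0] := eqVneq s [::].
  exists x; rewrite ?s0 ?mem_head // => y; rewrite inE => /eqP->.
  by rewrite mulfV ?H ?mem_head //; exact: subr_1.
have [//|y ys|m ms Hm] := IH; first by apply: H; rewrite inE ys orbT.
have m0 : m != 0 by apply: H; rewrite inE ms orbT.
have x0 : x != 0 by apply: H; rewrite mem_head.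
have [|h|h] := @valA (x / m); first by rewrite mulf_neq0 ?invr_eq0.
  exists m; first by rewrite inE ms orbT.
  by move=> y; rewrite inE => /orP[/eqP->|/Hm].
exists x; first by rewrite mem_head.
move=> y; rewrite inE => /orP[/eqP->|/Hm hy]; first by rewrite mulfV //; exact: subr_1.
have -> : y / x = (y / m) * (x / m)^-1 by field; rewrite x0 m0.
exact: subr_M.
Qed.

Let pZ_add (i j : int) : pC ^ (i + j) = pC ^ i * pC ^ j.
Proof. by rewrite expfzDr. Qed.

(** As for a Newton polygon: in an integral equation for [y] two terms have equal value, for
    otherwise the terms divided by the largest one would, apart from it, be non-units with sum $-1$.
    The quotient of the two terms is a unit, and their coefficients are powers of $p$ times
    units. *)
Let has_val_exists y : y != 0 -> exists Nj : nat * int, has_val y Nj.1 Nj.2.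
Proof.
move=> y0; have [q [Dq mq] dq] := minCpolyP y.
have [Q [a a0 DQ]] := rat_poly_scale q.
have Q0 : Q != 0.
  by apply: contraTneq mq => Q0; rewrite DQ Q0 rmorph0 scaler0 monicE lead_coef0 eq_sym oner_eq0.
pose t (i : nat) : algC := (Q`_i)%:~R * y ^+ i.
have sumt : \sum_(i <- iota 0 (size Q) | Q`_i != 0) t i = 0.
  have : (pQtoC q).[y] = 0 by apply/eqP; rewrite -/(root _ _) dq.
  rewrite DQ linearZ /= hornerZ => /eqP; rewrite mulf_eq0 fmorph_eq0 invr_eq0 intr_eq0 (negPf a0) /=.
  rewrite -map_poly_comp => /eqP e; rewrite -[RHS]e {e}.
  rewrite (@horner_coef_wide _ (size Q)) ?size_poly //.
  rewrite -[in RHS](big_mkord xpredT (fun i => (map_poly (ratr \o intr) Q)`_i * y ^+ i)).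
  rewrite /index_iota subn0 [LHS]big_mkcond /=; apply: eq_bigr => i _.
  rewrite coef_map_id0 /= ?rmorph0 // ratr_int /t; case: eqP => [->|//].
  by rewrite mul0r.
pose I := [seq i <- iota 0 (size Q) | Q`_i != 0].
rewrite -big_filter -/I in sumt.
have tI i : i \in I -> t i != 0.
  by rewrite mem_filter => /andP[h _]; rewrite mulf_neq0 ?intr_eq0 // expf_neq0.
have uI : uniq I by rewrite filter_uniq // iota_uniq.
have [||_ /mapP[k kI ->] max_k] := @max_term (map t I).
- rewrite -size_eq0 size_map size_eq0; apply/eqP => I0.
  have : (size Q).-1 \in I.
    rewrite mem_filter -/(lead_coef Q) lead_coef_eq0 Q0 mem_iota /= add0n.
    by rewrite prednK // lt0n size_poly_eq0.
  by rewrite I0.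
- by move=> _ /mapP[i iI ->]; exact: tI.
have [[i [iI ik Aki]]|no] := pselect (exists i, [/\ i \in I, i != k & A (t k / t i)]); last first.
  exfalso; have sum1 : \sum_(i <- rem k I) t i / t k = -1.
    rewrite -mulr_suml; apply: (canLR (mulfK (tI _ kI))); rewrite mulN1r.
    by move: sumt; rewrite (big_rem _ kI) /= addrC => /eqP; rewrite addr_eq0 => /eqP.
  have [i|_] := @nonunit_sum _ (rem k I) (fun i => t i / t k).
    rewrite mem_rem_uniq // inE => /andP[ik iI]; split; first by apply: max_k; apply: map_f.
    by rewrite invfM invrK mulrC => h; apply: no; exists i.
  rewrite sum1 => -[/eqP|]; first by rewrite oppr_eq0 oner_eq0.
  by apply; rewrite invrN invr1; apply: subr_N => //; exact: subr_1.
wlog lt_ki : i k iI kI ik {max_k} Aki / (k < i)%N /\ A (t i / t k).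
  move=> W; have Aik : A (t i / t k) by apply: max_k; apply: map_f.
  have [lt|lt|e] := ltngtP k i; last by rewrite e eqxx in ik.
    exact: (W i k).
  by apply: (W k i) => //; rewrite eq_sym.
case: lt_ki => lt_ki Aik.
have Uik : U (t i / t k) by split=> //; rewrite invfM invrK mulrC.
have [Qi0 Qk0] : Q`_i != 0 /\ Q`_k != 0.
  by move: iI kI; rewrite !mem_filter => /andP[-> _] /andP[-> _].
exists ((i - k)%N, (logn p `|Q`_i|)%:Z - (logn p `|Q`_k|)%:Z); split; first by rewrite subn_gt0.
have -> : y ^+ (i - k) * pC ^ ((logn p `|Q`_i|)%:Z - (logn p `|Q`_k|)%:Z) =
   (t i / t k) * ((Q`_i)%:~R / pC ^+ logn p `|Q`_i|)^-1 * ((Q`_k)%:~R / pC ^+ logn p `|Q`_k|).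
  have ey : y ^+ i = y ^+ (i - k) * y ^+ k by rewrite -exprD subnK // ltnW.
  rewrite pZ_add -exprnN -exprnP /t ey.
  have h1 : (Q`_i)%:~R != 0 :> algC by rewrite intr_eq0.
  have h2 : (Q`_k)%:~R != 0 :> algC by rewrite intr_eq0.
  have h3 : y ^+ k != 0 by rewrite expf_neq0.
  have h4 n : pC ^+ n != 0 by rewrite expf_neq0.
  by field; rewrite h1 h2 h3 !h4.
by apply: U_M; [apply: U_M => //; apply: U_V|]; exact: U_int.
Qed.

Let P0 : (0 : R) < p%:R. Proof. by rewrite ltr0n prime_gt0. Qed.
Let P1 : (1 : R) < p%:R. Proof. by rewrite ltr1n prime_gt1. Qed.

Let val_scale y N j n : (0 < n)%N -> has_val y N j -> has_val y (N * n) (j * n%:Z).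
Proof.
move=> n0 [N0 u]; split; first by rewrite muln_gt0 N0.
by rewrite exprM -exprz_exp -exprnP -exprMn; exact: U_X.
Qed.

Let val_uniq y N j N' j' : y != 0 -> has_val y N j -> has_val y N' j' ->
  j%:~R / N%:R = j'%:~R / N'%:R :> R.
Proof.
move=> y0; have aux n k k' : has_val y n k -> has_val y n k' -> ~ (k < k')%R.
  move=> [n0 [u _]] [_ [_ u']] lt; apply: (@pz_notA (k' - k)); first by rewrite subr_gt0.
  have -> : pC ^ (- (k' - k)) = (y ^+ n * pC ^ k) * (y ^+ n * pC ^ k')^-1.
    rewrite opprB pZ_add -invr_expz; have yn : y ^+ n != 0 by rewrite expf_neq0.
    have pk : pC ^ k' != 0 by rewrite expfz_neq0.
    by field; rewrite yn pk.
  exact: subr_M.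
move=> h h'; have [N0 _] := h; have [N0' _] := h'.
have e : j * N'%:Z = j' * N%:Z.
  have v1 := val_scale N0' h; have v2 := val_scale N0 h'; rewrite mulnC in v2.
  apply/eqP; rewrite eq_le !leNgt; apply/andP; split; apply/negP.
    exact: (aux _ _ _ v2 v1).
  exact: (aux _ _ _ v1 v2).
have n0 : N%:R != 0 :> R by rewrite pnatr_eq0 -lt0n.
have n0' : N'%:R != 0 :> R by rewrite pnatr_eq0 -lt0n.
apply/eqP; rewrite eqr_div // -[N'%:R]/((N'%:Z)%:~R) -[N%:R]/((N%:Z)%:~R) -!intrM.
by rewrite e.
Qed.

Let w (y : algC) : R :=
  match pselect (y != 0) with
  | left y0 => let Nj := sval (cid (has_val_exists y0)) in p%:R `^ (Nj.2%:~R / Nj.1%:R)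
  | right _ => 0
  end.

Let w0 : w 0 = 0.
Proof. by rewrite /w; case: pselect => // h; exfalso; rewrite eqxx in h. Qed.

Let wE y N j : y != 0 -> has_val y N j -> w y = p%:R `^ (j%:~R / N%:R).
Proof.
move=> y0 h; rewrite /w; case: pselect => // y0'.
by case: cid => -[N' j'] /= h'; rewrite (val_uniq y0 h' h).
Qed.

Let w_gt0 y : y != 0 -> 0 < w y.
Proof.
by move=> y0; have [[N j] /= h] := has_val_exists y0; rewrite (wE y0 h) powR_gt0.
Qed.

Let wM : {morph w : x y / x * y >-> x * y}.
Proof.
move=> x y; have [->|x0] := eqVneq x 0; first by rewrite mul0r w0 mul0r.
have [->|y0] := eqVneq y 0; first by rewrite mulr0 w0 mulr0.
have [[N j] /= h] := has_val_exists x0; have [[N' j'] /= h'] := has_val_exists y0.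
have [N0 _] := h; have [N0' _] := h'.
have [_ u] := val_scale N0' h; have [_ u'] := val_scale N0 h'.
have hxy : has_val (x * y) (N * N')%N (j * N'%:Z + j' * N%:Z).
  split; first by rewrite muln_gt0 N0.
  rewrite exprMn pZ_add mulrACA; apply: U_M => //.
  by rewrite mulnC.
rewrite (wE x0 h) (wE y0 h') (wE _ hxy) ?mulf_neq0 // -powRD; last by rewrite (gt_eqF P0) implybT.
congr (_ `^ _); rewrite natrM intrD !intrM.
have n0 : N%:R != 0 :> R by rewrite pnatr_eq0 -lt0n.
have n0' : N'%:R != 0 :> R by rewrite pnatr_eq0 -lt0n.
by rewrite -!pmulrn; field; rewrite n0 n0'.
Qed.

(** [A] contains [y] as soon as it contains $y^N$: if $1/y$ is in [A], then $y = y^N (1/y)^{N-1}$ is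
    too. *)
Let w_le1 y : y != 0 -> w y <= 1 <-> A y.
Proof.
move=> y0; have [[N j] /= h] := has_val_exists y0; rewrite (wE y0 h).
have [N0 [u u']] := h.
have n0 : 0 < N%:R :> R by rewrite ltr0n.
have -> : (p%:R `^ (j%:~R / N%:R) <= 1 :> R) = (j <= 0)%R.
  rewrite /powR (gt_eqF P0) -[X in _ <= X]expR0 ler_expR.
  rewrite pmulr_lle0 ?ln_gt0 //.
  by rewrite pmulr_lle0 ?invr_gt0 // lerz0.
have yN : y ^+ N = y ^+ N * pC ^ j * pC ^ (- j).
  by rewrite -mulrA -pZ_add subrr expr0z mulr1.
split=> [j0|Ay].
  have AyN : A (y ^+ N).
    rewrite yN; apply: subr_M => //.
    case: j j0 {h u u' yN} => [[|//]|n] _; first by rewrite oppr0; exact: subr_1.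
    by rewrite NegzE opprK; exact: subr_X.
  have [//|Ay'] := valA y0.
  have -> : y = y ^+ N * y^-1 ^+ N.-1.
    case: (N) N0 => // n _ /=; rewrite exprS exprVn mulfK // expf_neq0 //.
  by apply: subr_M => //; exact: subr_X.
rewrite leNgt; apply/negP => j0; apply: (pz_notA j0).
have -> : pC ^ (- j) = y ^+ N * (y ^+ N * pC ^ j)^-1.
  have yn : y ^+ N != 0 by rewrite expf_neq0.
  have pk : pC ^ j != 0 by rewrite expfz_neq0.
  by rewrite -invr_expz; field; rewrite yn pk.
by apply: subr_M => //; exact: subr_X.
Qed.

Let wU : ultrametric w.
Proof.
move=> x y; have [->|x0] := eqVneq x 0; first by rewrite add0r le_max lexx orbT.
have [->|y0] := eqVneq y 0; first by rewrite addr0 le_max lexx.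
have [->|s0] := eqVneq (x + y) 0; first by rewrite w0 le_max (ltW (w_gt0 x0)).
have aux a b : a != 0 -> b != 0 -> a + b != 0 -> A (b / a) -> w (a + b) <= w a.
  move=> a0 b0 ab0 Aba; have -> : a + b = a * (1 + b / a) by field.
  have s0' : 1 + b / a != 0.
    by apply: contra ab0 => /eqP e; have -> : a + b = a * (1 + b / a); [field|rewrite e mulr0].
  rewrite wM ler_piMr // ?(ltW (w_gt0 a0)) //; apply/(w_le1 s0').
  by apply: subr_D => //; exact: subr_1.
rewrite le_max; apply/orP.
have [|h|h] := @valA (y / x); first by rewrite mulf_neq0 ?invr_eq0.
  by left; apply: aux.
by right; rewrite addrC; apply: aux => //; rewrite 1?addrC //; rewrite invfM invrK mulrC in h.
Qed.

Let w_absval : absval w.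
Proof.
have ge0 x : 0 <= w x by have [->|/w_gt0/ltW//] := eqVneq x 0; rewrite w0.
split=> //.
- move=> x; split=> [wx|->//]; apply/eqP/negP => /negP/w_gt0; by rewrite wx ltxx.
- move=> x y; apply: le_trans (wU x y) _.
  by rewrite ge_max lerDl ge0 lerDr ge0.
Qed.

Let w_rat (q : rat) : w (ratr q) = padic_abs R p q.
Proof.
rewrite /padic_abs; case: eqP => [->|/eqP q0]; first by rewrite rmorph0 w0.
set j := (_ - _).
have n0 : numq q != 0 by rewrite numq_eq0.
have d0 : denq q != 0 by rewrite denq_neq0.
have h : has_val (ratr q) 1 j.
  split=> //; rewrite expr1.
  have -> : ratr q * pC ^ j = ((numq q)%:~R / pC ^+ logn p `|numq q|) *
     ((denq q)%:~R / pC ^+ logn p `|denq q|)^-1.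
    rewrite /j pZ_add -exprnN -exprnP /ratr.
    have h1 : (denq q)%:~R != 0 :> algC by rewrite intr_eq0.
    have h4 n : pC ^+ n != 0 by rewrite expf_neq0.
    by field; rewrite h1 !h4.
  by apply: U_M; [|apply: U_V]; exact: U_int.
rewrite (wE _ h) ?fmorph_eq0 // divr1 powR_intmul //; exact: ltW.
Qed.

Lemma padic_extension : exists w : algC -> R,
  [/\ absval w, ultrametric w & forall q, w (ratr q) = padic_abs R p q].
Proof. by exists w; split. Qed.

End PadicExtension.

Lemma fixed_poly_rat (P : {poly algC}) :
  (forall nu : {rmorphism algC -> algC}, map_poly nu P = P) ->
  exists r : {poly rat}, P = pQtoC r.
Proof.
move=> fP; have cP i : exists a, P`_i = ratr a.
  apply/CratP/Crat_fixed => nu.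
  by move/polyP: (fP nu) => /(_ i); rewrite coef_map.
have [r Hr] := choice cP; exists (\poly_(i < size P) r i).
apply/polyP => i; rewrite coef_map coef_poly /=; case: ltnP => h; first exact: Hr.
by rewrite rmorph0 nth_default.
Qed.

(** * Embeddings of a simple number field *)

Section Embeddings.
Variables (F : fieldExtType rat) (FC : {rmorphism F -> algC}) (x0 : F).
Hypothesis gen : <<1; x0>>%VS = fullv.
Let x := FC x0.

Lemma emb_uniq (f g : {rmorphism F -> algC}) : f x0 = g x0 -> f =1 g.
Proof.
move=> fg y; have : y \in <<1; x0>>%VS by rewrite gen memvf.
move=> /Fadjoin_polyP[p /polyOver1P[q ->] ->].
rewrite -!horner_map fg -!map_poly_comp; congr _.[_].
by apply: eq_map_poly => a /=; rewrite !rmorphZ_num !rmorph1.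
Qed.

(** The condition on [z] stands under the existential so that [emb] is total; its value is
    meaningful only at conjugates of [x]. *)
Lemma emb_exists (z : algC) : exists f : {rmorphism F -> algC}, z \in conjs x -> f x0 = z.
Proof.
have [/conj_autP[nu h]|h] := boolP (z \in conjs x); first by exists (nu \o FC).
by exists FC.
Qed.

Definition emb (z : algC) : {rmorphism F -> algC} := sval (cid (emb_exists z)).

Lemma emb_gen z : z \in conjs x -> emb z x0 = z.
Proof. by rewrite /emb; case: cid. Qed.

Lemma emb_id y : emb x y = FC y.
Proof. by apply: emb_uniq; rewrite emb_gen ?conjs_id. Qed.

Lemma emb_aut (nu : {rmorphism algC -> algC}) z y : z \in conjs x ->
  nu (emb z y) = emb (nu z) y.
Proof.
move=> zx; apply: (@emb_uniq (nu \o emb z)).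
change (nu (emb z x0) = emb (nu z) x0).
by rewrite !emb_gen ?mem_conjs_aut.
Qed.

Lemma emb_alg z a : emb z a%:A = ratr a.
Proof. by rewrite rmorphZ_num rmorph1 mulr1. Qed.

(** An automorphism of [algC] permutes the embeddings of [F]; hence traces and characteristic
    polynomials are rational. *)
Lemma big_emb_aut (T : Type) (idx : T) (op : Monoid.com_law idx) (G : algC -> T)
  (nu : {rmorphism algC -> algC}) y :
  \big[op/idx]_(z <- conjs x) G (nu (emb z y)) = \big[op/idx]_(z <- conjs x) G (emb z y).
Proof.
under eq_big_seq => z zx do rewrite emb_aut //.
rewrite -(big_map nu xpredT (fun z => G (emb z y))).
exact: perm_big (map_conjs_aut nu x).
Qed.

Lemma trace_rat y : exists q, \sum_(z <- conjs x) emb z y = ratr q.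
Proof.
apply/CratP/Crat_fixed => nu; rewrite rmorph_sum /=.
exact: (@big_emb_aut _ _ _ id).
Qed.

Lemma charpoly_rat y :
  exists r : {poly rat}, \prod_(z <- conjs x) ('X - (emb z y)%:P) = pQtoC r.
Proof.
apply: fixed_poly_rat => nu; rewrite rmorph_prod /=.
under eq_bigr => z _ do rewrite map_polyXsubC.
exact: (@big_emb_aut _ _ _ (fun a => 'X - a%:P)).
Qed.

End Embeddings.

(** If all roots are near 0, the polynomial is near a power of ['X]. The first bound also covers the
    leading coefficient; the induction step multiplies it by a root to gain the factor [e]. *)
Lemma small_roots_small_coefs (R : realType) (w : algC -> R) (s : seq algC) (e : R) i :
  absval w -> 0 <= e <= 1 -> (forall z, z \in s -> w z <= e) ->
  w (\prod_(z <- s) ('X - z%:P))`_i <= 2 ^+ size s /\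
  ((i < size s)%N -> w (\prod_(z <- s) ('X - z%:P))`_i <= 2 ^+ size s * e).
Proof.
move=> aw /andP[e0 e1]; elim: s i => [|z s IH] i H.
  rewrite big_nil coef1 /=; split=> //.
  by case: (i == 0)%N; rewrite ?(av1 aw) ?(av0 aw) ?ler01.
have {}IH j : _ := IH j (fun y ys => H y (mem_behead (s := z :: s) ys)).
have wz := H z (mem_head _ _); set P := \prod_(z <- s) _ in IH.
rewrite big_cons -/P mulrBl coefB mulrC coefMX coefCM /= exprS.
have p2 : (0 : R) <= 2 ^+ size s by rewrite exprn_ge0.
have hP j : w (z * P`_j) <= 2 ^+ size s * e.
  rewrite (avM aw) mulrC; apply: ler_pM => //; rewrite ?(av_ge0 aw) //.
  by have [] := IH j.
have hPe j : w (z * P`_j) <= 2 ^+ size s.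
  by apply: le_trans (hP j) _; rewrite ler_piMr.
split=> [|lt]; (apply: le_trans (avB aw _ _) _); rewrite -?mulrA mulr_natl mulr2n.
  apply: lerD => //; case: eqP => _; first by rewrite (av0 aw).
  by have [] := IH i.-1.
apply: lerD; last exact: hP.
case: eqP => [_|/eqP i0]; first by rewrite (av0 aw) mulr_ge0.
have [_ h] := IH i.-1; apply: h.
by rewrite -ltnS prednK // lt0n.
Qed.

(** * Places of a simple number field *)

Section Places.
Variables (R : realType) (F : fieldExtType rat) (FC : {rmorphism F -> algC}) (x0 : F).
Hypothesis gen : <<1; x0>>%VS = fullv.
Let x := FC x0.
Variables (b : rat -> R) (t : rat) (w : algC -> R).
Hypotheses (tb : 0 < b t < 1) (aw : absval w) (wb : forall q, w (ratr q) = b q).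

Local Notation emb := (emb FC x0).
Local Notation embw z := (w \o emb z).

Lemma embw_absval z : absval (embw z).
Proof. exact: absval_comp. Qed.

Lemma embw_place z : place_over (embw z) b.
Proof. by split; [exact: embw_absval|move=> q /=; rewrite -wb emb_alg]. Qed.

Lemma same_base_place (v v' : F -> R) : place_over v b -> place_over v' b -> same_base (t%:A : F) v v'.
Proof. by move=> [av ev] [av' ev']; split=> //; rewrite ?ev' ev. Qed.

(* If v differed from every [w \o emb z], weak approximation would give y close
   to 1 at v all of whose conjugates are small at w. Its characteristic
   polynomial would then be close to 'X^d, so y would be small at v too. *)
Lemma place_embw (v : F -> R) : place_over v b -> exists2 z, z \in conjs x & v = embw z.
Proof.
move=> pv; have [av vb] := pv; apply: contrapT => no.
pose d := size (conjs x).
(* The summand 2 makes $e \le 1/2$, so $1/2 \le v(y) \le 2$. The characteristic equation then gives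
   $2^{-d} \le v(y^d) \le d \cdot 2^d e \cdot 2^d$, that is $1 \le d\,8^d e$, which this [e]
   violates. *)
pose e : R := (d%:R * 8 ^+ d + 2)^-1.
have D0 : 0 < d%:R * 8 ^+ d + 2 :> R by rewrite ltr_wpDl // mulr_ge0 ?exprn_ge0.
have e0 : 0 < e by rewrite invr_gt0.
have e2 : e <= 2^-1.
  by rewrite lef_pV2 ?posrE // lerDr mulr_ge0 ?exprn_ge0.
have [|y [y1 ys]] := @weak_approximation R F (t%:A) v [seq embw z | z <- conjs x] e av _ e0.
  move=> _ /mapP[z zx ->]; split; first exact: same_base_place (embw_place z).
  by move=> vz; apply: no; exists z.
have [r Dr] := charpoly_rat FC gen y.
have sr : size r = d.+1.
  by rewrite -(size_map_poly (ratr : {rmorphism rat -> algC})) -Dr size_prod_XsubC.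
have r1 : r`_d = 1.
  have : (pQtoC r)`_d = 1.
    rewrite -Dr; have := monicP (monic_prod_XsubC (conjs x) xpredT (fun z => emb z y)).
    by rewrite lead_coefE Dr size_map_poly sr.
  by rewrite coef_map /= -[1 in RHS](rmorph1 (ratr : {rmorphism rat -> algC})) => /fmorph_inj.
have ry : \sum_(i < d.+1) r`_i *: y ^+ i = 0.
  apply: (fmorph_inj FC); rewrite rmorph0 rmorph_sum /=.
  have : (pQtoC r).[FC y] = 0.
    apply/eqP; rewrite -Dr -/(root _ _).
    rewrite -(big_map (fun z => emb z y) xpredT (fun a => 'X - a%:P)) root_prod_XsubC.
    by rewrite -(emb_id FC gen y); apply: (map_f (fun z => emb z y)); exact: conjs_id.
  rewrite (@horner_coef_wide _ d.+1) ?size_map_poly ?sr // => e0'; rewrite -[RHS]e0' {e0'}.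
  by apply: eq_bigr => i _; rewrite coef_map rmorphZ_num rmorphXn.
have v2 : v y <= 2.
  by have := avB_le av y 1; rewrite (av1 av); move: y1 e2; lra.
have v1 : 2^-1 <= v y.
  by have := avB_le av 1 y; rewrite (av1 av) (av_distC av); move: y1 e2; lra.
have le1 : v (y ^+ d) <= \sum_(i < d) v (r`_i *: y ^+ i).
  move: ry; rewrite big_ord_recr /= r1 scale1r addrC => /eqP; rewrite addr_eq0 => /eqP ->.
  by rewrite (avN av); exact: av_sum.
have le2 : \sum_(i < d) v (r`_i *: y ^+ i) <= d%:R * (4 ^+ d * e).
  rewrite -[d in d%:R]card_ord mulr_natl -sumr_const; apply: ler_sum => i _.
  rewrite -mulr_algl (avM av) vb -wb (avX av).
  have -> : (4 : R) ^+ d * e = (2 ^+ d * e) * 2 ^+ d.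
    by rewrite mulrAC -exprMn -natrM.
  apply: ler_pM; rewrite ?(av_ge0 aw) ?exprn_ge0 ?(av_ge0 av) //.
    have [||_] := @small_roots_small_coefs R w [seq emb z y | z <- conjs x] e i aw.
    - by rewrite (ltW e0) (le_trans e2) // invf_le1 // ler1n.
    - by move=> _ /mapP[z zx ->]; apply/ltW/(ys (embw z))/map_f.
    by rewrite big_map Dr coef_map size_map -/d; apply.
  apply: (@le_trans _ _ (2 ^+ i)); first by rewrite lerXn2r // ?nnegrE // (av_ge0 av).
  by rewrite ler_weXn2l ?ler1n // ltnW.
have le3 : 2^-1 ^+ d <= v (y ^+ d) by rewrite (avX av) lerXn2r ?nnegrE ?(av_ge0 av) ?invr_ge0.
have := le_trans le3 (le_trans le1 le2).
rewrite exprVn -div1r ler_pdivrMr ?exprn_gt0 // leNgt => /negP; apply.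
have -> : d%:R * (4 ^+ d * e) * 2 ^+ d = (d%:R * 8 ^+ d) * e.
  have -> : (8 : R) ^+ d = 4 ^+ d * 2 ^+ d by rewrite -exprMn -natrM.
  ring.
by rewrite /e ltr_pdivrMr // mul1r ltrDl.
Qed.

End Places.

(** * Local degrees *)

Section CompletionDimension.
Variables (R : realType) (F : fieldExtType rat) (v : F -> R).
Hypothesis av : absval v.
Implicit Types (u : nat -> F) (c : nat -> rat).

Lemma null_ext u u' : u =1 u' -> null_seq v u -> null_seq v u'.
Proof. by move=> /funext ->. Qed.

Lemma null_cst x : null_seq v (fun=> x) -> x = 0.
Proof.
move=> n; apply/eqP/negP => /negP x0; rewrite -(av_gt0 av) in x0.
by have [N /(_ N (leqnn N))] := n _ x0; rewrite ltxx.
Qed.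

Lemma null_D u u' : null_seq v u -> null_seq v u' -> null_seq v (u \+ u').
Proof.
move=> n n' e e0; have e2 : 0 < e / 2 by rewrite divr_gt0.
have [N HN] := n _ e2; have [N' HN'] := n' _ e2.
exists (maxn N N') => k; rewrite geq_max => /andP[/HN h /HN' h'].
by apply: le_lt_trans (avD av _ _) _; lra.
Qed.

Lemma null_sum d (u : 'I_d -> nat -> F) : (forall i, null_seq v (u i)) ->
  null_seq v (fun n => \sum_i u i n).
Proof.
elim: d u => [|d IH] u H.
  by move=> e e0; exists 0%N => n _; rewrite big_ord0 (av0 av).
apply: null_ext (null_D (IH _ (fun i => H (widen_ord (leqnSn d) i))) (H ord_max)) => n.
by rewrite big_ord_recr.
Qed.

Lemma null_M u u' B : null_seq v u -> (forall n, v (u' n) <= B) ->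
  null_seq v (fun n => u' n * u n).
Proof.
move=> n HB e e0; have B0 : 0 < B + 1.
  by rewrite ltr_wpDl // (le_trans (av_ge0 av (u' 0)) (HB 0)).
have [N HN] := n (e / (B + 1)) (divr_gt0 e0 B0).
exists N => k /HN; rewrite ltr_pdivlMr // => h; apply: le_lt_trans h.
by rewrite (avM av) mulrC ler_wpM2l ?(av_ge0 av) // (le_trans (HB k)) // lerDl.
Qed.

Lemma cauchy_bounded u : cauchy_seq v u -> exists B, forall n, v (u n) <= B.
Proof.
move=> cu; have [N HN] := cu 1 ltr01.
exists (\sum_(i < N.+1) v (u i) + 1) => n.
have [le|lt] := leqP N n.
  have := HN n N le (leqnn N) => h.
  have := avB_le av (u n) (u N) => h'.
  have : v (u N) <= \sum_(i < N.+1) v (u i).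
    by rewrite (bigD1 ord_max) //= lerDl sumr_ge0 // => i _; rewrite (av_ge0 av).
  lra.
rewrite (bigD1 (Ordinal (leqW lt))) //= -addrA lerDl addr_ge0 //.
by rewrite sumr_ge0 // => i _; rewrite (av_ge0 av).
Qed.

Lemma cauchy_M u u' : cauchy_seq v u -> cauchy_seq v u' ->
  cauchy_seq v (fun n => u n * u' n).
Proof.
move=> cu cu'; have [B HB] := cauchy_bounded cu; have [B' HB'] := cauchy_bounded cu'.
have B0 : 0 < B + 1 by rewrite ltr_wpDl // (le_trans (av_ge0 av (u 0)) (HB 0)).
have B0' : 0 < B' + 1 by rewrite ltr_wpDl // (le_trans (av_ge0 av (u' 0)) (HB' 0)).
move=> e e0; have [N HN] := cu (e / 2 / (B' + 1)) ltac:(by rewrite !divr_gt0).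
have [N' HN'] := cu' (e / 2 / (B + 1)) ltac:(by rewrite !divr_gt0).
exists (maxn N N') => m n; rewrite !geq_max => /andP[m1 m2] /andP[n1 n2].
have h := HN m n m1 n1; have h' := HN' m n m2 n2.
rewrite ltr_pdivlMr // in h; rewrite ltr_pdivlMr // in h'.
have -> : u m * u' m - u n * u' n = (u m - u n) * u' m + u n * (u' m - u' n) by ring.
apply: le_lt_trans (avD av _ _) _; rewrite !(avM av).
have le1 : v (u m - u n) * v (u' m) <= v (u m - u n) * (B' + 1).
  by rewrite ler_wpM2l ?(av_ge0 av) // (le_trans (HB' m)) // lerDl.
have le2 : v (u n) * v (u' m - u' n) <= v (u' m - u' n) * (B + 1).
  by rewrite mulrC ler_wpM2l ?(av_ge0 av) // (le_trans (HB n)) // lerDl.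
lra.
Qed.

Lemma cauchy_D u u' : cauchy_seq v u -> cauchy_seq v u' -> cauchy_seq v (u \+ u').
Proof.
move=> cu cu' e e0; have e2 : 0 < e / 2 by rewrite divr_gt0.
have [N HN] := cu _ e2; have [N' HN'] := cu' _ e2.
exists (maxn N N') => m n; rewrite !geq_max => /andP[m1 m2] /andP[n1 n2].
have h := HN m n m1 n1; have h' := HN' m n m2 n2.
have -> : (u \+ u') m - (u \+ u') n = (u m - u n) + (u' m - u' n) by rewrite /=; ring.
by apply: le_lt_trans (avD av _ _) _; lra.
Qed.

Lemma cauchy_cst x : cauchy_seq v (fun=> x).
Proof. by move=> e e0; exists 0%N => m n _ _; rewrite subrr (av0 av). Qed.

Lemma cauchy_ext u u' : u =1 u' -> cauchy_seq v u -> cauchy_seq v u'.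
Proof. by move=> /funext ->. Qed.

Lemma cauchy_sum d (u : 'I_d -> nat -> F) : (forall i, cauchy_seq v (u i)) ->
  cauchy_seq v (fun n => \sum_i u i n).
Proof.
elim: d u => [|d IH] u H.
  by apply: cauchy_ext (cauchy_cst 0) => n; rewrite big_ord0.
apply: cauchy_ext (cauchy_D (IH _ (fun i => H (widen_ord (leqnSn d) i))) (H ord_max)) => n.
by rewrite big_ord_recr.
Qed.

(* Change-of-basis matrices A, B between two bases satisfy AB = 1 and BA = 1 in
   the limit, and tr (AB) = tr (BA). *)
Lemma completion_basis_card d d' (b : 'I_d -> nat -> F) (b' : 'I_d' -> nat -> F) :
  completion_basis v b -> completion_basis v b' -> d = d'.
Proof.
have half e e' (g : 'I_e -> nat -> F) (g' : 'I_e' -> nat -> F)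
    (A : 'I_e' -> 'I_e -> nat -> rat) (B : 'I_e -> 'I_e' -> nat -> rat) :
    completion_basis v g' ->
    (forall j i, qcauchy v (A j i)) -> (forall i j, qcauchy v (B i j)) ->
    (forall j, null_seq v (g' j \- qcomb (A j) g)) ->
    (forall i, null_seq v (g i \- qcomb (B i) g')) ->
    null_seq v (fun n => (e'%:R - \sum_j \sum_i A j i n * B i j n)%:A).
  move=> [_ _ ind] cA cB nA nB.
  pose c j k n : rat := (j == k)%:R - \sum_i A j i n * B i k n.
  have cc j k : qcauchy v (c j k).
    have h := cauchy_D (cauchy_cst (j == k)%:R%:A)
      (cauchy_M (cauchy_cst (-1)) (cauchy_sum (fun i => cauchy_M (cA j i) (cB i k)))).
    apply: cauchy_ext h => n /=; rewrite /c scalerBl mulN1r; congr (_ - _).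
    by rewrite scaler_suml; apply: eq_bigr => i _; rewrite -scalerAl mul1r scalerA.
  have nc j : null_seq v (qcomb (c j) g').
    have hM i : null_seq v (fun n => (A j i n)%:A * (g i \- qcomb (B i) g') n).
      have [Bd HB] := cauchy_bounded (cA j i).
      exact: null_M (nB i) HB.
    apply: null_ext (null_D (nA j) (null_sum hM)) => n /=.
    rewrite /qcomb /c.
    under [X in _ - X + _]eq_bigr => i _ do rewrite -mulr_algl.
    under [X in _ - _ + X]eq_bigr => i _ do rewrite mulrBr.
    rewrite sumrB addrA subrK.
    under [RHS]eq_bigr => k _ do rewrite scalerBl.
    rewrite sumrB; congr (_ - _).
      rewrite (bigD1 j) //= eqxx scale1r big1 ?addr0 // => k kj.
      by rewrite eq_sym (negPf kj) scale0r.
    under eq_bigr => i _ do rewrite mulr_algl scaler_sumr.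
    rewrite exchange_big /=; apply: eq_bigr => k _.
    by rewrite scaler_suml; apply: eq_bigr => i _; rewrite scalerA.
  have hn := null_sum (fun j => ind _ (cc j) (nc j) j).
  apply: null_ext hn => n /=.
  rewrite -scaler_suml; congr (_ *: _); rewrite /c sumrB; congr (_ - _).
  under eq_bigr => j _ do rewrite eqxx.
  by rewrite sumr_const card_ord.
move=> cb cb'; have [cb1 span _] := cb; have [cb1' span' _] := cb'.
have ex1 j : exists cj : 'I_d -> nat -> rat, (forall i, qcauchy v (cj i)) /\
    null_seq v (b' j \- qcomb cj b) by have [c] := span _ (cb1' j); exists c.
have ex2 i : exists ci : 'I_d' -> nat -> rat, (forall j, qcauchy v (ci j)) /\
    null_seq v (b i \- qcomb ci b') by have [c] := span' _ (cb1 i); exists c.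
have [A HA] := choice ex1; have [B HB] := choice ex2.
have h1 := half _ _ _ _ A B cb' (fun j => (HA j).1) (fun i => (HB i).1)
  (fun j => (HA j).2) (fun i => (HB i).2).
have h2 := half _ _ _ _ B A cb (fun j => (HB j).1) (fun i => (HA i).1)
  (fun j => (HB j).2) (fun i => (HA i).2).
have : (d%:R - d'%:R : rat)%:A = 0 :> F.
  apply: null_cst.
  have m1 (n : nat) : v (-1) <= 1 by rewrite (avN av) (av1 av).
  apply: null_ext (null_D h2 (@null_M _ (fun=> -1) 1 h1 m1)) => n /=.
  rewrite mulN1r -scalerBl; congr (_ *: _).
  rewrite exchange_big /=.
  under eq_bigr => i _ do under eq_bigr => j _ do rewrite mulrC.
  ring.
by move/eqP; rewrite scaler_eq0 oner_eq0 orbF subr_eq0 eqr_nat => /eqP.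
Qed.

Lemma local_degreeE d (b : 'I_d -> nat -> F) :
  completion_basis v b -> local_degree v = d.
Proof.
move=> cb; rewrite /local_degree; case: xgetP => [y _ [b' cb']|/(_ d)[]].
  exact: completion_basis_card cb' cb.
by exists b.
Qed.

End CompletionDimension.

(** By Cramer's formula the entries are quotients of determinants. *)
Lemma invmx_rpred (L : fieldType) (K : divringClosed L) n (M : 'M[L]_n) :
  (forall i j, M i j \in K) -> forall i j, invmx M i j \in K.
Proof.
have detK m (A : 'M[L]_m) : (forall i j, A i j \in K) -> \det A \in K.
  move=> AK; apply: rpred_sum => s _.
  by rewrite rpredM ?rpredX ?rpredN1 // rpred_prod.
move=> MK i j; rewrite /invmx; case: ifP => // _.
rewrite !mxE rpredM ?rpredV ?detK // /cofactor rpredM ?rpredX ?rpredN1 // detK //.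
by move=> k l; rewrite !mxE.
Qed.

(** * The local degree counts the embeddings that induce the place *)

Section LocalDegree.
Variables (R : realType) (F : fieldExtType rat) (FC : {rmorphism F -> algC}) (x0 : F).
Hypothesis gen : <<1; x0>>%VS = fullv.
Let x := FC x0.
Variables (b : rat -> R) (t : rat) (w : algC -> R).
Hypotheses (tb : 0 < b t < 1) (aw : absval w) (wb : forall q, w (ratr q) = b q).

Local Notation emb := (emb FC x0).
Local Notation embw z := (w \o emb z).

Variable v : F -> R.
Hypothesis pv : place_over v b.
Let av : absval v := pv.1.
Let vb : forall q, v q%:A = b q := pv.2.

Let S : seq algC := [seq z <- conjs x | embw z == v].

Let S_conj z : z \in S -> z \in conjs x.
Proof. by rewrite mem_filter => /andP[]. Qed.

Let S_v z y : z \in S -> w (emb z y) = v y.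
Proof. by rewrite mem_filter => /andP[/eqP <-]. Qed.

(** The closure of the rationals under [w]: the part of $\mathbb{Q}_p$ visible in [algC]. *)
Definition rat_limit (a : algC) : Prop :=
  forall e, 0 < e -> exists q : rat, w (a - ratr q) < e.

(* Multiplying by an element close to 1 at v and to 0 at the other places over
   the same place of Q turns the global trace into the local one. *)
Lemma local_trace_limit y : rat_limit (\sum_(z <- S) emb z y).
Proof.
move=> e e0; pose W := \sum_(z <- conjs x) w (emb z y).
have W0 : 0 <= W by apply: sumr_ge0 => z _; rewrite (av_ge0 aw).
have W1 : 0 < W + 1 by rewrite ltr_wpDl.
pose d := e / (W + 1); have d0 : 0 < d by rewrite divr_gt0.
pose vs := [seq embw z | z <- conjs x & embw z != v].
have [|a [a1 as_]] := @weak_approximation R F t%:A v vs d av _ d0.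
  move=> v' /mapP[z]; rewrite mem_filter => /andP[zv zx] ->{v'}; split.
    by apply: (same_base_place tb pv); exact: embw_place.
  by move=> e1; rewrite -e1 eqxx in zv.
have [q Dq] := trace_rat FC gen (a * y).
exists q; rewrite -Dq [X in _ - X](bigID (fun z => embw z == v)) /= opprD addrA /S big_filter -sumrB.
apply: (@le_lt_trans _ _ (d * W)); last first.
  by rewrite /d mulrAC ltr_pdivrMr // ltr_pM2l // ltrDl.
apply: le_trans (avB aw _ _) _; rewrite /W [X in _ <= _ * X](bigID (fun z => embw z == v)) /= mulrDr.
apply: lerD; apply: le_trans (av_sum aw _ _ _) _; rewrite mulr_sumr big_seq_cond [leRHS]big_seq_cond;
  apply: ler_sum => z /andP[zx zv].
  have zS : z \in S by rewrite mem_filter zv.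
  rewrite -rmorphB !S_v // -{1}[y]mul1r -mulrBl (avM av) ler_wpM2r ?(av_ge0 av) //.
  by rewrite (av_distC av) ltW.
rewrite rmorphM (avM aw) ler_wpM2r ?(av_ge0 aw) // ltW // (as_ (embw z)) //.
by apply: (map_f (fun z => embw z)); rewrite mem_filter zv.
Qed.

Let rat_limits : {pred algC} := fun a => `[< rat_limit a >].

Let rat_limit_divring : divring_closed rat_limits.
Proof.
split.
- by apply/asboolP => e e0; exists 1; rewrite rmorph1 subrr (av0 aw).
- move=> a c /asboolP ha /asboolP hc; apply/asboolP => e e0.
  have e2 : 0 < e / 2 by rewrite divr_gt0.
  have [q Hq] := ha _ e2; have [r Hr] := hc _ e2; exists (q - r).
  have -> : a - c - ratr (q - r) = (a - ratr q) - (c - ratr r) by rewrite rmorphB; ring.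
  by apply: le_lt_trans (avB aw _ _) _; lra.
move=> a c /asboolP ha /asboolP hc; apply/asboolP.
have limV : rat_limit c^-1.
  have [->|c0] := eqVneq c 0; first by rewrite invr0 => e e0; exists 0; rewrite rmorph0 subrr (av0 aw).
  have wc : 0 < w c by rewrite (av_gt0 aw).
  move=> e e0; pose d := Num.min (w c / 2) (e * (w c * (w c / 2))).
  have d0 : 0 < d by rewrite lt_min divr_gt0 // !mulr_gt0 // invr_gt0.
  have [r Hr] := hc _ d0; exists r^-1; move: Hr; rewrite lt_min => /andP[h1 h2].
  have wr : w c / 2 <= w (ratr r) by have := avB_le aw c (ratr r); lra.
  have r0 : ratr r != 0 :> algC by rewrite -(av_gt0 aw); apply: lt_le_trans wr; rewrite divr_gt0.
  have -> : c^-1 - ratr r^-1 = - (c - ratr r) / (c * ratr r) by rewrite fmorphV; field; rewrite c0 r0.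
  rewrite (av_div aw) (avN aw) (avM aw) ltr_pdivrMr; last by rewrite mulr_gt0 // (av_gt0 aw).
  apply: lt_le_trans h2 _; rewrite ler_pM2l // ler_pM2l //.
move: (c^-1) limV => c' hc' e e0.
have B0 : 0 < w c' + 1 by rewrite ltr_wpDl // (av_ge0 aw).
have [q Hq] := ha (e / 2 / (w c' + 1)) ltac:(by rewrite !divr_gt0).
have Q0 : 0 < w (ratr q) + 1 by rewrite ltr_wpDl // (av_ge0 aw).
have [r Hr] := hc' (e / 2 / (w (ratr q) + 1)) ltac:(by rewrite !divr_gt0).
exists (q * r); rewrite ltr_pdivlMr // in Hq; rewrite ltr_pdivlMr // in Hr.
have -> : a * c' - ratr (q * r) = (a - ratr q) * c' + ratr q * (c' - ratr r) by rewrite rmorphM; ring.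
apply: le_lt_trans (avD aw _ _) _; rewrite (avM aw _ c') (avM aw (ratr q)).
have l1 : w (a - ratr q) * w c' <= w (a - ratr q) * (w c' + 1).
  by rewrite ler_wpM2l ?(av_ge0 aw) // lerDl.
have l2 : w (ratr q) * w (c' - ratr r) <= w (c' - ratr r) * (w (ratr q) + 1).
  by rewrite mulrC ler_wpM2l ?(av_ge0 aw) // lerDl.
apply: le_lt_trans (lerD l1 l2) _; rewrite [ltRHS](splitr e); exact: ltrD.
Qed.

Let Qlim : divringClosed algC :=
  HB.pack rat_limits (GRing.isDivringClosed.Build algC rat_limits rat_limit_divring).

Let m := size S.
Let V : 'M[algC]_m := \matrix_(i, j) S`_j ^+ i.

Let S_nth (j : 'I_m) : S`_j \in S. Proof. exact: mem_nth. Qed.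

Let V_unit : V \in unitmx.
Proof.
have -> : V = Vandermonde m (\row_j S`_j) by apply/matrixP => i j; rewrite !mxE.
rewrite unitmxE det_Vandermonde unitfE.
apply/prodf_neq0 => i _; apply/prodf_neq0 => j lt; rewrite !mxE subr_eq0.
rewrite nth_uniq ?ltn_ord // ?filter_uniq ?conjs_uniq //.
by rewrite neq_ltn lt orbT.
Qed.

Let VT_unit : V^T \in unitmx. Proof. by rewrite unitmx_tr. Qed.

(** The constant sequences $1, x_0, \dots, x_0^{m-1}$ will be the basis of the completion over
    $\mathbb{Q}_p$. *)
Let pw (i : 'I_m) : F := x0 ^+ i.
Let lc (c : 'I_m -> rat) : F := \sum_i c i *: pw i.

Let emb_lc c (j : 'I_m) : emb S`_j (lc c) = \sum_i ratr (c i) * S`_j ^+ i.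
Proof.
rewrite rmorph_sum; apply: eq_bigr => i _.
by rewrite rmorphZ_num rmorphXn /= emb_gen // S_conj.
Qed.

(** The coefficients are recovered by the inverse Vandermonde matrix from the [m] embeddings of
    [lc c], all of which have size [v (lc c)] under [w]. This yields both independence and the
    Cauchy property of coefficients. *)
Let coef_bound : exists2 C, 0 < C & forall (c : 'I_m -> rat) i, b (c i) <= C * v (lc c).
Proof.
pose IV := invmx V^T.
pose C := \sum_i \sum_j w (IV i j) + 1.
have row_ge0 i : 0 <= \sum_j w (IV i j) by apply: sumr_ge0 => j _; rewrite (av_ge0 aw).
exists C; first by rewrite ltr_wpDl // sumr_ge0.
move=> c i; pose cc : 'cV[algC]_m := \col_i ratr (c i).
pose ec : 'cV[algC]_m := \col_j emb S`_j (lc c).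
have e1 : V^T *m cc = ec.
  by apply/matrixP => j k; rewrite !mxE emb_lc; apply: eq_bigr => l _; rewrite !mxE mulrC.
have e2 : cc = IV *m ec by rewrite -e1 mulKmx.
have -> : b (c i) = w (cc i 0) by rewrite mxE wb.
rewrite e2 mxE; apply: le_trans (av_sum aw _ _ _) _.
apply: (@le_trans _ _ ((\sum_j w (IV i j)) * v (lc c))).
  by rewrite mulr_suml; apply: ler_sum => j _; rewrite (avM aw) !mxE S_v.
rewrite ler_wpM2r ?(av_ge0 av) // /C [X in _ <= X + _](bigD1 i) //= -addrA lerDl addr_ge0 // sumr_ge0 //.
Qed.

(** The Vandermonde system determines [a]. Multiplying it by [V] turns matrix and right-hand side
    into local traces of $x_0^{k+l}$ and of $x_0^j u$, which are limits of rationals; hence so is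
    the solution. *)
Let emb_surj (u : F) : exists2 a : 'I_m -> algC, forall i, rat_limit (a i) &
  forall j : 'I_m, emb S`_j u = \sum_i a i * S`_j ^+ i.
Proof.
pose ev : 'cV[algC]_m := \col_j emb S`_j u.
pose a := invmx V^T *m ev; exists (fun i => a i 0); last first.
  move=> j; have -> : emb S`_j u = (V^T *m a) j 0 by rewrite mulKVmx // mxE.
  by rewrite mxE; apply: eq_bigr => i _; rewrite !mxE mulrC.
have Va : a = invmx (V *m V^T) *m (V *m ev).
  have U2 : V *m V^T \in unitmx by rewrite unitmx_mul V_unit.
  have e : ev = V^T *m a by rewrite mulKVmx.
  by rewrite [in RHS]e mulmxA mulKmx.
have lim (f : nat -> F) g : (forall j, j \in S -> forall k, g j k = emb j (f k)) ->
    forall k, \sum_(j < m) g S`_j k \in Qlim.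
  move=> fg k; apply/asboolP.
  have -> : \sum_(j < m) g S`_j k = \sum_(z <- S) emb z (f k).
    rewrite (big_nth 0) big_mkord; apply: eq_bigr => j _.
    by rewrite fg.
  exact: local_trace_limit.
move=> i; suff : a i 0 \in Qlim by move=> /asboolP.
rewrite Va mxE; apply: rpred_sum => j _.
apply: rpredM.
  apply: invmx_rpred => k l; rewrite mxE.
  have := @lim (fun n => x0 ^+ n) (fun z n => z ^+ n) _ (k + l)%N.
  rewrite (eq_bigr (fun j => V k j * V^T j l)); first apply.
    by move=> z zS n; rewrite rmorphXn /= emb_gen // S_conj.
  by move=> j' _; rewrite !mxE exprD.
rewrite mxE.
have := @lim (fun n => x0 ^+ n * u) (fun z n => z ^+ n * emb z u) _ j.
rewrite (eq_bigr (fun k => V j k * ev k 0)); first apply.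
  by move=> z zS n; rewrite rmorphM rmorphXn /= emb_gen // S_conj.
by move=> k _; rewrite !mxE.
Qed.

Let dense (u : F) e : 0 < e -> exists c, v (u - lc c) < e.
Proof.
move=> e0; have [a lim_a Da] := emb_surj u.
have [z1 z1x vz1] := place_embw FC gen tb aw wb pv.
have z1S : z1 \in S by rewrite mem_filter -vz1 eqxx.
have ltj : (index z1 S < m)%N by rewrite index_mem.
pose j := Ordinal ltj; have Sj : S`_j = z1 by rewrite nth_index.
pose B := \sum_(i < m) w z1 ^+ i.
have B0 : 0 <= B by apply: sumr_ge0 => i _; rewrite exprn_ge0 // (av_ge0 aw).
have B1 : 0 < B + 1 by rewrite ltr_wpDl.
have ex i : exists q : rat, w (a i - ratr q) < e / (B + 1) by apply: lim_a; rewrite divr_gt0.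
have [c Hc] := choice ex; exists c.
rewrite -(S_v (u - lc c) z1S) rmorphB -Sj Da emb_lc -sumrB.
apply: (@le_lt_trans _ _ (e / (B + 1) * B)); last first.
  by rewrite mulrAC ltr_pdivrMr // ltr_pM2l // ltrDl.
apply: le_trans (av_sum aw _ _ _) _; rewrite /B mulr_sumr; apply: ler_sum => i _.
rewrite -mulrBl (avM aw) (avX aw) Sj ler_wpM2r ?exprn_ge0 ?(av_ge0 aw) //.
exact: ltW.
Qed.

(** [dense] gives the spanning property, and [coef_bound] turns closeness of combinations into
    closeness of their coefficients. *)
Lemma local_degree_count : local_degree v = count (fun z => embw z == v) (conjs x).
Proof.
rewrite -size_filter -/S -/m; apply: (@local_degreeE _ _ _ av m (fun i _ => pw i)).
have [C C0 HC] := coef_bound.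
have lcB c c' : lc c - lc c' = lc (fun i => c i - c' i).
  by rewrite /lc -sumrB; apply: eq_bigr => i _; rewrite scalerBl.
split.
- by move=> i; exact: cauchy_cst.
- move=> u cu.
  have ex n : exists c, v (u n - lc c) < n.+1%:R^-1 by apply: dense; rewrite invr_gt0.
  have [c Hc] := choice ex.
  exists (fun i n => c n i) => [i e e0|].
    pose d := e / C / 3; have d0 : 0 < d by rewrite !divr_gt0.
    have [N HN] := cu d d0.
    pose N' := Num.bound d^-1.
    have small n : (N' <= n)%N -> n.+1%:R^-1 < d :> R.
      move=> le; rewrite invf_plt ?posrE //.
      apply: (lt_le_trans (archi_boundP _)); first by rewrite invr_ge0 ltW.
      by rewrite ler_nat leqW.
    exists (maxn N N') => k n; rewrite !geq_max => /andP[k1 k2] /andP[n1 n2].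
    have h1 := lt_trans (Hc k) (small k k2); have h2 := lt_trans (Hc n) (small n n2).
    have h3 := HN k n k1 n1.
    rewrite -scalerBl vb; apply: le_lt_trans (HC (fun i => c k i - c n i) i) _.
    rewrite -lcB.
    have -> : lc (c k) - lc (c n) = (u k - u n) - ((u k - lc (c k)) - (u n - lc (c n))) by ring.
    have h4 : v ((u k - u n) - ((u k - lc (c k)) - (u n - lc (c n)))) < e / C.
      apply: le_lt_trans (avB av _ _) _; have := avB av (u k - lc (c k)) (u n - lc (c n)).
      by rewrite /d in h1 h2 h3; lra.
    by move: h4; rewrite ltr_pdivlMr // mulrC.
  move=> e e0; exists (Num.bound e^-1) => n le; apply: lt_trans (Hc n) _.
  rewrite invf_plt ?posrE //.
  apply: (lt_le_trans (archi_boundP _)); first by rewrite invr_ge0 ltW.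
  by rewrite ler_nat leqW.
move=> c cc nc i e e0; have [N HN] := nc (e / C) (divr_gt0 e0 C0).
exists N => n /HN; rewrite ltr_pdivlMr // mulrC => h; rewrite vb.
exact: le_lt_trans (HC (fun i => c i n) i) h.
Qed.

End LocalDegree.

(** * The Gauss norm *)

Section GaussNorm.
Variables (R : realType) (K : fieldType) (w : K -> R).
Hypotheses (aw : absval w) (uw : ultrametric w).

Lemma ultrametric_dominant a b : w a < w b -> w (a + b) = w b.
Proof.
move=> ab; apply/eqP; rewrite eq_le; apply/andP; split.
  by apply: le_trans (uw a b) _; rewrite ge_max lexx (ltW ab).
have := uw (a + b) (- a); rewrite addrAC subrr add0r (avN aw) le_max => /orP[//|].
by rewrite leNgt ab.
Qed.

Lemma prod_max1_ge1 (I : Type) (s : seq I) (P : pred I) (F : I -> R) :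
  1 <= \prod_(z <- s | P z) Num.max 1 (F z).
Proof.
elim/big_rec: _ => // z y _ le; rewrite -[leLHS]mulr1 ler_pM //.
by rewrite le_max lexx.
Qed.

(** Index [k], the number of roots in the closed unit ball, is the last one at which the largest
    coefficient occurs. Strictness beyond [k] lets one term dominate when a root of that ball is
    added. *)
Lemma gauss_norm_aux (s : seq K) :
  let N := \prod_(z <- s) Num.max 1 (w z) in
  let k := count (fun z => w z <= 1) s in
  let P := \prod_(z <- s) ('X - z%:P) in
  [/\ forall i, w P`_i <= N, w P`_k = N & forall i, (k < i)%N -> w P`_i < N].
Proof.
elim: s => [|z s [IHle IHeq IHlt]] /=.
  rewrite !big_nil; split=> [i||i i0]; rewrite coef1 ?(av1 aw) //.
    by case: (i == 0)%N; rewrite ?(av1 aw) ?(av0 aw) ?ler01.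
  by rewrite eqn0Ngt i0 (av0 aw).
set N := \prod_(z <- s) Num.max _ _ in IHle IHeq IHlt.
set k := count _ _ in IHeq IHlt.
set P := \prod_(z <- s) (_ - _) in IHle IHeq IHlt.
have N1 : 1 <= N by exact: prod_max1_ge1.
have N0 : 0 < N by apply: lt_le_trans N1.
rewrite !big_cons -/N -/P mulrBl.
have cE i : ('X * P - z%:P * P)`_i = (if (i == 0)%N then 0 else P`_i.-1) - z * P`_i.
  by rewrite coefB mulrC coefMX coefCM.
have le1 i : w (if (i == 0)%N then 0 else P`_i.-1) <= N.
  by case: ifP => _ //; rewrite (av0 aw) ltW.
have [z1|z1] := lerP (w z) 1; rewrite ?add0n ?add1n.
  rewrite mul1r; split=> [i||i lt]; rewrite cE.
  - apply: le_trans (uw _ _) _; rewrite ge_max le1 (avN aw) (avM aw) /=.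
    by apply: le_trans (IHle i); rewrite ler_piMl ?(av_ge0 aw).
  - rewrite /= addrC ultrametric_dominant // (avN aw) (avM aw) IHeq.
    apply: le_lt_trans (IHlt k.+1 (ltnSn k)); rewrite ler_piMl ?(av_ge0 aw) //.
  - apply: le_lt_trans (uw _ _) _; rewrite gt_max (avN aw) (avM aw).
    case: i lt => // i lt /=; rewrite IHlt //=.
    apply: le_lt_trans (IHlt i.+1 (ltnW lt)); by rewrite ler_piMl ?(av_ge0 aw).
have lt0 : N < w z * N by rewrite ltr_pMl.
split=> [i||i lt]; rewrite cE.
- apply: le_trans (uw _ _) _; rewrite ge_max (le_trans (le1 i) (ltW lt0)) /=.
  by rewrite (avN aw) (avM aw) ler_wpM2l ?(av_ge0 aw).
- rewrite ultrametric_dominant ?(avN aw) ?(avM aw) ?IHeq //.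
  exact: le_lt_trans (le1 _) lt0.
apply: le_lt_trans (uw _ _) _; rewrite gt_max (le_lt_trans (le1 i) lt0) /=.
rewrite (avN aw) (avM aw) ltr_pM2l ?IHlt //.
exact: lt_trans z1.
Qed.

Lemma coef_prod_XsubC_le (s : seq K) i :
  w (\prod_(z <- s) ('X - z%:P))`_i <= \prod_(z <- s) Num.max 1 (w z).
Proof. by case: (gauss_norm_aux s). Qed.

Lemma coef_prod_XsubC_eq (s : seq K) : exists i,
  w (\prod_(z <- s) ('X - z%:P))`_i = \prod_(z <- s) Num.max 1 (w z).
Proof. by case: (gauss_norm_aux s); exists (count (fun z => w z <= 1) s). Qed.

End GaussNorm.

(** * Integer polynomials and p-adic absolute values *)

Section PadicInt.
Variables (R : realType) (p : nat).
Hypothesis pp : prime p.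

Lemma padic_abs_int (z : int) : z != 0 ->
  padic_abs R p z%:~R = p%:R ^- logn p `|z|.
Proof.
move=> z0; rewrite /padic_abs intr_eq0 (negPf z0) denq_int numq_int logn1 sub0r.
by rewrite exprnN.
Qed.

Lemma padic_abs_int_le1 (z : int) : padic_abs R p z%:~R <= 1.
Proof.
have [->|z0] := eqVneq z 0; first by rewrite /padic_abs eqxx ler01.
rewrite padic_abs_int // invf_le1 ?exprn_gt0 ?ltr0n ?prime_gt0 //.
by rewrite exprn_ege1 // ler1n prime_gt0.
Qed.

Lemma padic_abs_int_eq1 (z : int) : ~~ (p %| `|z|)%N -> padic_abs R p z%:~R = 1.
Proof.
move=> nd; have z0 : z != 0 by apply: contraNneq nd => ->; rewrite absz0 dvdn0.
rewrite padic_abs_int // lognE pp absz_gt0 z0 (negPf nd) expr0 invr1 //.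
Qed.

(** The largest coefficient of a primitive polynomial has $p$-adic size 1, and it equals the size of
    the leading coefficient times the Gauss norm of the monic factor. *)
Lemma gauss_norm_primitive (w : algC -> R) (q : {poly int}) (s : seq algC) :
  absval w -> ultrametric w -> (forall a, w (ratr a) = padic_abs R p a) ->
  zcontents q = 1 ->
  pZtoC q = (lead_coef q)%:~R *: \prod_(z <- s) ('X - z%:P) ->
  \prod_(z <- s) Num.max 1 (w z) = p%:R ^+ logn p `|lead_coef q|.
Proof.
move=> aw uw wp cq Dq; set N := \prod_(z <- s) _.
have wz (z : int) : w z%:~R = padic_abs R p z%:~R by rewrite -wp ratr_int.
have q0 : lead_coef q != 0.
  by rewrite lead_coef_eq0; apply/eqP => e; move: cq; rewrite e zcontents0.
have cE i : w (q`_i)%:~R = w (lead_coef q)%:~R * w (\prod_(z <- s) ('X - z%:P))`_i.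
  by rewrite -(avM aw) -coefZ -Dq coef_map.
have a0 : 0 < w (lead_coef q)%:~R by rewrite (av_gt0 aw) intr_eq0.
have e1 : w (lead_coef q)%:~R * N = 1.
  apply/eqP; rewrite eq_le; apply/andP; split.
    have [i Hi] := coef_prod_XsubC_eq aw uw s.
    by rewrite /N -Hi -cE wz padic_abs_int_le1.
  have [i nd] : exists i : nat, ~~ (p %| absz (q`_i)%R)%N.
    apply: contrapT => /forallNP h.
    have : (p%:Z %| zcontents q)%Z.
      rewrite dvdz_contents; apply/polyOverP => i.
      by have /negP := h i; rewrite negbK.
    rewrite cq dvdzE /= dvdn1 => /eqP p1; by move: pp; rewrite p1.
  rewrite -(padic_abs_int_eq1 nd) -wz cE ler_pM2l //.
  exact: coef_prod_XsubC_le.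
rewrite -[LHS](mulKf (lt0r_neq0 a0)) e1 mulr1 wz padic_abs_int // invrK //.
Qed.

End PadicInt.

Lemma primitive_minpoly (x : algC) : exists2 q : {poly int}, zcontents q = 1 &
  pZtoC q = (lead_coef q)%:~R *: minCpoly x.
Proof.
have [p [Dp mp] dp] := minCpolyP x.
have [q [a a0 Dq]] := rat_poly_scale p.
have q0 : q != 0.
  by apply: contraTneq mp => q0; rewrite Dq q0 rmorph0 scaler0 monicE lead_coef0 eq_sym oner_eq0.
have c0 : zcontents q != 0 by rewrite zcontents_eq0.
exists (zprimitive q); first by rewrite zcontents_primitive q0.
have [c Dc] : exists c : algC, pZtoC (zprimitive q) = c *: minCpoly x.
  exists (a%:~R / (zcontents q)%:~R).
  have -> : minCpoly x = (a%:~R^-1 * (zcontents q)%:~R) *: pZtoC (zprimitive q).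
    rewrite Dp Dq linearZ /= -scalerA; congr (_ *: _); first by rewrite fmorphV rmorph_int.
    rewrite -map_poly_comp {1}[q]zpolyEprim linearZ /= ratr_int; congr (_ *: _).
    by apply: eq_map_poly => b /=; rewrite ratr_int.
  rewrite scalerA; set k := _ * _; suff -> : k = 1 by rewrite scale1r.
  by rewrite /k; field; rewrite !intr_eq0 a0 c0.
rewrite Dc; congr (_ *: _).
have := congr1 lead_coef Dc; rewrite lead_coef_map_inj ?rmorph0 //; last exact: intr_inj.
by rewrite lead_coefZ (monicP (minCpoly_monic x)) mulr1 => ->.
Qed.

(** * The Mahler measure as a product over conjugates *)

Section ArchimedeanValue.
Variables (R : realType) (iota : {rmorphism algC -> R[i]}).

Definition absC (z : algC) : R := Normc.normc (iota z).

Lemma absC_absval : absval absC.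
Proof.
split=> [x|x|x y|x y]; rewrite /absC.
- by case: (iota x) => a b /=; rewrite sqrtr_ge0.
- split=> [/Normc.eq0_normc/eqP|->]; last by rewrite rmorph0 Normc.normc0.
  by rewrite fmorph_eq0 => /eqP.
- by rewrite rmorphM Normc.normcM.
- by rewrite rmorphD; exact: le_normcD.
Qed.

Lemma absC_rat q : absC (ratr q) = archi_abs R q.
Proof.
rewrite /absC /archi_abs fmorph_rat -(fmorph_rat (real_complex R)) /=.
by rewrite expr0n /= addr0 sqrtr_sqr.
Qed.

End ArchimedeanValue.

Lemma height_in_seq (R : realType) (F : fieldExtType rat) (x : F) (r : seq (F -> R)) :
  uniq r -> (forall v, v \in r -> places v) ->
  (forall v, places v -> v \notin r -> Num.max 1 (normalized_abs v x) = 1) ->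
  height_in R x = \prod_(v <- r) Num.max 1 (normalized_abs v x).
Proof.
move=> ur rp pr; rewrite fsbig_seq //; apply/esym/fsbig_widen => [v /rp //|v [pv /negP nr]].
exact: pr.
Qed.

Section MahlerFormula.
Variables (R : realType) (iota : {rmorphism algC -> R[i]}) (x : algC).

Let F := Qadj x.
Let x0 : F := Qadj_gen x.

Let FC_ex : exists FC : {rmorphism F -> algC}, FC x0 = x /\ <<1; x0>>%VS = fullv.
Proof.
rewrite /x0 /F /Qadj_gen /Qadj; case: (num_field_exists [:: x]) => Q [QC [s Ds gs]] /=.
exists QC; case: s Ds gs => [|y [|//]] //= [<-]; rewrite adjoin_cons adjoin_nil => <-.
by split=> //; rewrite subfield_closed.
Qed.

Let FC := sval (cid FC_ex).
Let FCx : FC x0 = x := (svalP (cid FC_ex)).1.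
Let gen : <<1; x0>>%VS = fullv := (svalP (cid FC_ex)).2.

(* The places of Q: [None] is the archimedean one. *)
Let valid (o : option nat) := if o is Some p then prime p else true.
Let base (o : option nat) : rat -> R :=
  if o is Some p then padic_abs R p else archi_abs R.

Let base_ext o : exists w : algC -> R, valid o ->
  [/\ absval w, forall q, w (ratr q) = base o q & o <> None -> ultrametric w].
Proof.
case: o => [p|] /=; last first.
  exists (absC iota) => _; split=> //; [exact: absC_absval|exact: absC_rat].
have [/(padic_extension R)[w [aw uw wp]]|np] := boolP (prime p); first by exists w.
by exists (fun=> 0).
Qed.

(** No choice is made at the archimedean place, where the formula names [absC iota]. *)
Let w o : algC -> R := if o is Some p then sval (cid (base_ext o)) else absC iota.

Let wP o : valid o ->
  [/\ absval (w o), forall q, w o (ratr q) = base o q & o <> None -> ultrametric (w o)].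
Proof.
case: o => [p|] vo; last by split=> //; [exact: absC_absval|exact: absC_rat].
by rewrite /w; case: cid => w' /= /(_ vo).
Qed.

Let base_small o : valid o -> exists t, 0 < base o t < 1.
Proof.
case: o => [p|] /= vo.
  exists p%:~R; rewrite padic_abs_int; last by rewrite -lt0n prime_gt0.
  rewrite absz_nat logn_prime // eqxx expr1.
  have p1 : 1 < p%:R :> R by rewrite ltr1n prime_gt1.
  by rewrite invr_gt0 invf_lt1 ltr0n prime_gt0.
exists (2^-1); rewrite /archi_abs fmorphV rmorph_nat ger0_norm ?invr_ge0 //.
by rewrite invr_gt0 ltr0n invf_lt1 // ltr1n.
Qed.

Let base_inj o o' : valid o -> valid o' -> base o = base o' -> o = o'.
Proof.
have arch_padic p : prime p -> archi_abs R <> padic_abs R p.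
  move=> pp /(congr1 (fun f => f p%:~R)).
  rewrite padic_abs_int; last by rewrite -lt0n prime_gt0.
  rewrite /archi_abs ratr_int absz_nat logn_prime // eqxx expr1 ger0_norm ?ler0z //.
  have p1 : 1 < p%:R :> R by rewrite ltr1n prime_gt1.
  move=> e; have : (p%:R : R) ^-1 < 1 by rewrite invf_lt1 // (lt_trans _ p1).
  by rewrite -e ltNge (ltW p1).
case: o o' => [p|] [p'|] //= vo vo' e; last 2 first.
- by case: (arch_padic p).
- by case: (arch_padic p').
congr Some; apply/eqP/negP => /negP pp'.
have := congr1 (fun f => f p%:~R) e; rewrite padic_abs_int; last by rewrite -lt0n prime_gt0.
rewrite padic_abs_int_eq1 //; last by rewrite absz_nat dvdn_prime2 // eq_sym.
rewrite absz_nat logn_prime // eqxx expr1 => /eqP; rewrite invr_eq1 pnatr_eq1 => /eqP p1.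
by move: vo; rewrite p1.
Qed.

Local Notation embw o z := (w o \o emb FC x0 z).
Let L o := undup [seq embw o z | z <- conjs x].

Let L_place o v : valid o -> v \in L o -> place_over v (base o).
Proof.
move=> vo; rewrite mem_undup => /mapP[z zx ->]; have [aw wb _] := wP vo.
exact: embw_place.
Qed.

Let place_L o v : valid o -> place_over v (base o) -> v \in L o.
Proof.
move=> vo pv; have [aw wb _] := wP vo; have [t tb] := base_small vo.
have [z] := place_embw FC gen tb aw wb pv; rewrite FCx => zx ->.
by rewrite mem_undup; apply: (map_f (fun z => embw o z)).
Qed.

Let D := \dim {:F}.
Let D0 : (0 < D)%N. Proof. exact: adim_gt0. Qed.

Let factor (v : F -> R) := Num.max 1 (normalized_abs v x0).

Let factorX v : absval v -> factor v ^+ D = Num.max 1 (v x0) ^+ local_degree v.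
Proof.
move=> av; rewrite /factor /normalized_abs -/D; set m := local_degree v.
have DR : (D%:R : R) != 0 by rewrite pnatr_eq0 -lt0n.
have r0 : 0 <= v x0 by rewrite (av_ge0 av).
have e : (v x0 `^ (m%:R / D%:R)) ^+ D = v x0 ^+ m.
  by rewrite -powR_mulrn ?powR_ge0 // -powRrM divfK // powR_mulrn.
have p0 : 0 <= v x0 `^ (m%:R / D%:R) by rewrite powR_ge0.
have [v1|v1] := lerP (v x0) 1.
  rewrite expr1n; have -> : Num.max 1 (v x0 `^ (m%:R / D%:R)) = 1; last by rewrite expr1n.
  apply/max_idPl; rewrite leNgt; apply/negP => lt.
  have : 1 < (v x0 `^ (m%:R / D%:R)) ^+ D by rewrite exprn_egt1 // -lt0n.
  by rewrite e ltNge exprn_ile1.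
have -> : Num.max 1 (v x0 `^ (m%:R / D%:R)) = v x0 `^ (m%:R / D%:R); last by [].
apply/max_idPr; rewrite leNgt; apply/negP => lt.
have : (v x0 `^ (m%:R / D%:R)) ^+ D < 1 by rewrite exprn_ilt1 // -lt0n.
by rewrite e ltNge exprn_ege1 // ltW.
Qed.

(** Grouping the conjugates by the place they induce, each [v] occurs [local_degree v] times, the
    exponent left in [factorX]. *)
Let prod_L o : valid o ->
  \prod_(v <- L o) factor v ^+ D = \prod_(z <- conjs x) Num.max 1 (w o z).
Proof.
move=> vo; have [aw wb _] := wP vo; have [t tb] := base_small vo.
pose f z := embw o z.
have -> : \prod_(z <- conjs x) Num.max 1 (w o z) =
   \prod_(v <- map f (conjs x)) Num.max 1 (v x0).
  rewrite big_map; apply: eq_big_seq => z zx.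
  by rewrite /f /= emb_gen // FCx.
rewrite -[RHS]big_undup_iterop_count; apply: eq_big_seq => v vL.
have pv := L_place vo vL; rewrite factorX; last by case: pv.
by rewrite (local_degree_count FC gen tb aw wb pv) FCx count_map.
Qed.

Let L_disjoint o o' v : valid o -> valid o' -> v \in L o -> v \in L o' -> o = o'.
Proof.
move=> vo vo' /(L_place vo)[_ e] /(L_place vo')[_ e']; apply: base_inj => //.
by apply/funext => q; rewrite -e -e'.
Qed.

Lemma mahler_formula (q : {poly int}) : zcontents q = 1 ->
  pZtoC q = (lead_coef q)%:~R *: minCpoly x ->
  mahler R x = (lead_coef q)%:~R * \prod_(z <- conjs x) Num.max 1 (absC iota z).
Proof.
move=> cq Dq; pose a := `|lead_coef q|%N.
have q0 : lead_coef q != 0.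
  by rewrite lead_coef_eq0; apply/eqP => e; move: cq; rewrite e zcontents0.
have a0 : (0 < a)%N by rewrite absz_gt0.
have lcE : (lead_coef q)%:~R = a%:R :> R.
  have : 0 < lead_coef q by rewrite -sgz_gt0 -sgz_contents cq sgz1.
  by move=> h; rewrite /a -[in LHS](gtz0_abs h).
have Gp p : prime p -> \prod_(z <- conjs x) Num.max 1 (w (Some p) z) = p%:R ^+ logn p a.
  move=> pp; have [aw wb uw] := @wP (Some p) pp.
  by apply: gauss_norm_primitive => //; [exact: uw|rewrite Dq minCpoly_conjs].
(* At a prime not dividing [a] the product in [Gp] is 1, so every conjugate has size at most 1 there
   and all factors over that prime are 1. *)
pose os := None :: map Some (primes a).
have vos o : o \in os -> valid o.
  rewrite inE => /orP[/eqP-> //|/mapP[p]]; rewrite mem_primes => /andP[pp _] -> //.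
have uos : uniq os.
  rewrite /= map_inj_uniq ?primes_uniq ?andbT; last by move=> ? ? [].
  by apply/negP => /mapP[].
pose r := flatten (map L os).
have ur : uniq r.
  rewrite /r; elim: (os) uos vos => [|o s IH] //= /andP[no us] vs.
  rewrite cat_uniq undup_uniq IH // ?andbT; last by move=> o' h; apply: vs; rewrite inE h orbT.
  apply/hasPn => v /flattenP[_ /mapP[o' o's ->] vL']; apply/negP => vL.
  have := L_disjoint (vs o (mem_head _ _)) (vs o' _) vL vL'.
  by rewrite inE o's orbT => /(_ isT) e; rewrite e o's in no.
have hE : height_in R x0 = \prod_(v <- r) factor v.
  apply: height_in_seq ur _ _ => v.
    move=> /flattenP[_ /mapP[o oos ->] vL].
    have := L_place (vos o oos) vL; case: o oos vL => [p|] oos vL pv; last by left.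
    by right; exists p => //; exact: (vos _ oos).
  move=> pl /negP nr.
  have [o [vo pv]] : exists o, valid o /\ place_over v (base o).
    by case: pl => [pv|[p pp pv]]; [exists None|exists (Some p)].
  have vL := place_L vo pv; have [av _] := pv.
  have noos : o \notin os.
    by apply/negP => oos; apply: nr; apply/flattenP; exists (L o) => //; apply: map_f.
  case: o vo pv vL noos => [p|] // pp pv vL; rewrite inE /= => npa.
  have {}npa : logn p a = 0%N.
    apply/eqP; rewrite -leqn0 leqNgt logn_gt0; apply/negP => h.
    by move/negP: npa; apply; apply: map_f.
  have := Gp p pp; rewrite npa expr0 => G1.
  have : v x0 <= 1.
    move: vL; rewrite mem_undup => /mapP[z zx ->] /=; rewrite emb_gen ?FCx //.
    have := G1; rewrite (big_rem z zx) /= => G2.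
    have h1 := prod_max1_ge1 (rem z (conjs x)) xpredT (w (Some p)).
    have h2 : 1 <= Num.max 1 (w (Some p) z) by rewrite le_max lexx.
    have : Num.max 1 (w (Some p) z) <= 1.
      by rewrite -[leRHS]G2 ler_peMr // (le_trans ler01).
    by rewrite ge_max => /andP[].
  move=> v1; apply/max_idPl; rewrite /normalized_abs; set c := _ / _.
  apply: (@le_trans _ _ (1 `^ c)); last by rewrite powR1.
  by rewrite ge0_ler_powR // ?nnegrE ?(av_ge0 av) // divr_ge0.
rewrite /mahler /weil_height -/x0 hE -prodrXl big_flatten big_map.
have -> : \prod_(o <- os) \prod_(v <- L o) factor v ^+ D =
          \prod_(o <- os) \prod_(z <- conjs x) Num.max 1 (w o z).
  by apply: eq_big_seq => o /vos; exact: prod_L.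
rewrite big_cons /= big_map mulrC; congr (_ * _).
rewrite lcE {2}(prod_prime_decomp a0) prime_decompE big_map natr_prod.
apply: eq_big_seq => p; rewrite mem_primes => /andP[pp _].
by rewrite Gp // natrX.
Qed.

End MahlerFormula.

(** * Local integrality *)

Lemma pQtoC_pZtoQ (P : {poly int}) : pQtoC (pZtoQ P) = pZtoC P.
Proof. by rewrite -map_poly_comp; apply: eq_map_poly => a /=; rewrite ratr_int. Qed.

Lemma rat_int_of_padic (R : realType) (q : rat) :
  (forall p, prime p -> padic_abs R p q <= 1) -> exists z : int, q = z%:~R.
Proof.
move=> h; have [e|d1] := eqVneq (denq q) 1.
  by exists (numq q); rewrite numqE e mulr1.
exfalso; have d2 : (1 < `|denq q|)%N.
  rewrite ltn_neqAle absz_gt0 denq_neq0 andbT; apply: contra d1 => /eqP e.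
  by rewrite -absz_denq -e.
pose p := pdiv `|denq q|; have pp : prime p := pdiv_prime d2.
have pd : (p %| `|denq q|)%N := pdiv_dvd _.
have q0 : q != 0 by apply: contraTneq d2 => ->.
have pn : ~~ (p %| `|numq q|)%N.
  apply/negP => pn; have := coprime_num_den q; rewrite /coprime => /eqP e.
  have : (p %| 1)%N by rewrite -e dvdn_gcd pn pd.
  by rewrite dvdn1 => /eqP p1; move: pp; rewrite p1.
have := h p pp; rewrite /padic_abs (negPf q0).
rewrite (lognE p `|numq q|) (negPf pn) !andbF subr0 -exprnP leNgt => /negP; apply.
by rewrite exprn_egt1 ?ltr1n ?prime_gt1 // -lt0n logn_gt0 mem_primes pp absz_gt0 denq_neq0.
Qed.

(** Quantifying over all extensions [w] makes the notion invariant under automorphisms, so that it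
    passes to conjugates and to the coefficients of the minimal polynomial. *)
Definition locally_integral (R : realType) (z : algC) : Prop :=
  forall (p : nat) (w : algC -> R), prime p -> absval w -> ultrametric w ->
    (forall q, w (ratr q) = padic_abs R p q) -> w z <= 1.

Section LocallyIntegral.
Variable R : realType.

Lemma locally_integral_rat (q : rat) : locally_integral R (ratr q) ->
  exists z : int, q = z%:~R.
Proof.
move=> lq; apply: (@rat_int_of_padic R) => p pp.
by have [w [aw uw wp]] := padic_extension R pp; rewrite -wp (lq p).
Qed.

Lemma locally_integral_poly (r : {poly rat}) :
  (forall i : nat, locally_integral R (ratr r`_i)) -> exists P : {poly int}, r = pZtoQ P.
Proof.
move=> lr; have [f Hf] := choice (fun i => locally_integral_rat (lr i)).
exists (\poly_(i < size r) f i); apply/polyP => i; rewrite coef_map coef_poly /=.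
by case: ltnP => h //; rewrite nth_default.
Qed.

Lemma locally_integral_aut (nu : {rmorphism algC -> algC}) z :
  locally_integral R z -> locally_integral R (nu z).
Proof.
move=> lz p w pp aw uw wp; apply: (lz p (w \o nu)) => //.
- exact: absval_comp.
- by move=> x y /=; rewrite rmorphD.
- by move=> q /=; rewrite fmorph_rat.
Qed.

Lemma locally_integral_coef (s : seq algC) i :
  (forall z, z \in s -> locally_integral R z) ->
  locally_integral R (\prod_(z <- s) ('X - z%:P))`_i.
Proof.
move=> ls p w pp aw uw wp; apply: le_trans (coef_prod_XsubC_le aw uw s i) _.
rewrite big_seq big1 // => z zs; apply/max_idPl; exact: ls zs p w pp aw uw wp.
Qed.

Lemma locally_integral_Aint z : locally_integral R z -> z \in Aint.
Proof.
move=> lz; have [r [Dr mr] _] := minCpolyP z.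
have [|P DP] := @locally_integral_poly r.
  move=> i; have -> : ratr r`_i = (minCpoly z)`_i by rewrite Dr coef_map.
  rewrite minCpoly_conjs; apply: locally_integral_coef => y /conj_autP[nu <-].
  exact: locally_integral_aut.
rewrite unfold_in Dr DP pQtoC_pZtoQ; apply/polyOverP => i.
by rewrite coef_map /= rpred_int.
Qed.

End LocallyIntegral.

(** * Mahler measures and integer polynomials *)

Section MahlerBounds.
Variables (R : realType) (iota : {rmorphism algC -> R[i]}).
Local Notation A := (absC iota).
Let aA : absval A := absC_absval iota.

Lemma absC_int (z : int) : A z%:~R = `|z%:~R|.
Proof. by rewrite -ratr_int absC_rat /archi_abs ratr_int. Qed.

Lemma lead_primitive_gt0 (q : {poly int}) : zcontents q = 1 -> 0 < lead_coef q.
Proof. by move=> cq; rewrite -sgz_gt0 -sgz_contents cq sgz1. Qed.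

Lemma mahler_ge1 x : 1 <= mahler R x.
Proof.
have [q cq Dq] := primitive_minpoly x; rewrite (mahler_formula iota cq Dq).
rewrite -[leLHS]mulr1 ler_pM ?prod_max1_ge1 // ler1z.
by rewrite -gtz0_ge1 lead_primitive_gt0.
Qed.

Lemma mahler_ge0 x : 0 <= mahler R x.
Proof. exact: le_trans ler01 (mahler_ge1 x). Qed.

Lemma prod_max1_perm (s t : seq algC) : perm_eq s t ->
  \prod_(z <- s) Num.max 1 (A z) = \prod_(z <- t) Num.max 1 (A z).
Proof. exact: perm_big. Qed.

(** The primitive minimal polynomial of [x] divides [P] over the integers, and the cofactor
    contributes a factor at least 1. *)
Lemma mahler_le x (P : {poly int}) (s : seq algC) : P != 0 ->
  pZtoC P = (lead_coef P)%:~R *: \prod_(z <- s) ('X - z%:P) -> x \in s ->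
  mahler R x <= `|(lead_coef P)%:~R| * \prod_(z <- s) Num.max 1 (A z).
Proof.
move=> P0 DP xs; have [q cq Dq] := primitive_minpoly x.
have q0 := lead_primitive_gt0 cq.
have lP0 : (lead_coef P)%:~R != 0 :> algC by rewrite intr_eq0 lead_coef_eq0.
have qP : q %| P.
  rewrite -dvdp_rat_int; have [p [Dp _] dp] := minCpolyP x.
  have -> : pZtoQ q = (lead_coef q)%:~R *: p.
    apply: (map_poly_inj (ratr : {rmorphism rat -> algC})).
    by rewrite pQtoC_pZtoQ Dq linearZ /= Dp ratr_int.
  rewrite dvdpZl ?intr_eq0 ?gt_eqF // -dp pQtoC_pZtoQ DP rootZ // root_prod_XsubC //.
have [r Dr] := dvdpP_int qP.
have {}Dr : P = q * r by rewrite Dr [q in RHS]zpolyEprim cq scale1r.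
have [rs Drs] := closed_field_poly_normal (pZtoC r).
have lrE : lead_coef (pZtoC r) = (lead_coef r)%:~R.
  by rewrite lead_coef_map_inj ?rmorph0 //; exact: intr_inj.
have perm : perm_eq s (conjs x ++ rs).
  apply: prod_XsubC_eq; apply: (scalerI lP0); rewrite -DP Dr rmorphM /= Dq Drs lrE.
  by rewrite lead_coefM rmorphM /= -scalerAl -scalerAr scalerA big_cat minCpoly_conjs.
rewrite (prod_max1_perm perm) big_cat /= (mahler_formula iota cq Dq) Dr lead_coefM rmorphM /=.
rewrite normrM [in leRHS]gtr0_norm ?ltr0z // -mulrA ler_wpM2l ?ler0z ?(ltW q0) //.
rewrite mulrCA ler_peMr ?(le_trans ler01) ?prod_max1_ge1 //.
rewrite -[leLHS]mulr1 ler_pM ?prod_max1_ge1 //.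
have r0 : r != 0 by apply: contraNneq P0 => r0; rewrite Dr r0 mulr0.
by rewrite -intr_norm ler1z -gtz0_ge1 normr_gt0 lead_coef_eq0.
Qed.

Lemma max1X (x : R) n : 0 <= x -> Num.max 1 x ^+ n = Num.max 1 (x ^+ n).
Proof.
move=> x0; have [x1|x1] := lerP x 1; first by rewrite expr1n; apply/esym/max_idPl/exprn_ile1.
by apply/esym/max_idPr/exprn_ege1/ltW.
Qed.

Lemma mahler_unity_root z k : (0 < k)%N -> z ^+ k = 1 -> mahler R z <= 1.
Proof.
move=> k0 zk; pose P : {poly int} := 'X^k - 1.
have mP : P \is monic by rewrite monicXnsubC.
have [s Ds] := closed_field_poly_normal (pZtoC P).
have lP : lead_coef (pZtoC P) = 1.
  by rewrite lead_coef_map_inj ?rmorph0 ?(monicP mP) //; exact: intr_inj.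
have PE : pZtoC P = 'X^k - 1 by rewrite rmorphB rmorph1 /= map_polyXn.
rewrite lP scale1r in Ds.
have sE y : (y \in s) = (y ^+ k == 1).
  by rewrite -root_prod_XsubC -Ds PE /root !hornerE subr_eq0.
have := @mahler_le z P s (monic_neq0 mP); rewrite (monicP mP) rmorph1 scale1r => /(_ Ds).
rewrite sE zk eqxx => /(_ isT); rewrite normr1 mul1r big_seq big1 //.
move=> y; rewrite sE => /eqP yk; apply/max_idPl.
have : A y ^+ k = 1 by rewrite -(avX aA) yk (av1 aA).
move=> e; rewrite leNgt; apply/negP => lt.
have : 1 < A y ^+ k by rewrite exprn_egt1 // -lt0n.
by rewrite e ltxx.
Qed.

End MahlerBounds.

(** * The fixed field of the automorphisms fixing all conjugates of alpha *)

Section FixedField.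
Variable alpha : algC.
Implicit Types (mu nu : {rmorphism algC -> algC}).

Definition fixes nu : Prop := forall c, c \in conjs alpha -> nu c = c.

Definition in_fixed (z : algC) : Prop := forall nu, fixes nu -> nu z = z.

Lemma fixes_comp nu mu : fixes nu -> fixes mu -> fixes (nu \o mu).
Proof. by move=> hn hm c cx /=; rewrite hm // hn. Qed.

Lemma fixes_inv nu : fixes nu -> fixes (algC_invaut nu).
Proof. by move=> hn c cx; rewrite /= -[in LHS](hn c cx) algC_autK. Qed.

(** Normality of H: [mu] permutes [conjs alpha]. *)
Lemma fixes_conj nu mu : fixes nu -> fixes (algC_invaut mu \o nu \o mu).
Proof. by move=> hn c cx /=; rewrite hn ?algC_autK // mem_conjs_aut. Qed.

Lemma in_fixed_aut mu z : in_fixed z -> in_fixed (mu z).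
Proof.
move=> fz nu hn; have := fz _ (fixes_conj mu hn).
by move/(congr1 mu) => /=; rewrite algC_invautK.
Qed.

Lemma in_fixedM y z : in_fixed y -> in_fixed z -> in_fixed (y * z).
Proof. by move=> fy fz nu hn; rewrite rmorphM fy // fz. Qed.

Lemma in_fixedN z : in_fixed z -> in_fixed (- z).
Proof. by move=> fz nu hn; rewrite rmorphN fz. Qed.

Lemma in_fixed_galois_closure z : in_fixed z -> galois_closure alpha z.
Proof.
move=> fz K [dK nK] aK; apply: (@fixed_mem_divring (conjs alpha)) => // c.
by rewrite mem_conjs => /(nK alpha c aK).
Qed.

Let m := size (conjs alpha).

(** A conjugate [nu z] depends only on the action of [nu] on [conjs alpha]. Counting all self-maps
    of that set is crude, but uniform in [z]. *)
Lemma in_fixed_conjs z : in_fixed z -> (size (conjs z) <= #|{ffun 'I_m -> 'I_m}|)%N.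
Proof.
move=> fz; set d := size (conjs z).
have ex (i : 'I_d) : exists nu, nu z = (conjs z)`_i.
  by have [|nu h] := @conj_autP z (conjs z)`_i; [rewrite mem_nth|exists nu].
have [nu Hnu] := choice ex.
have lt (i : 'I_d) (j : 'I_m) : (index (nu i ((conjs alpha)`_j)%R) (conjs alpha) < m)%N.
  by rewrite index_mem mem_conjs_aut mem_nth.
pose f i : {ffun 'I_m -> 'I_m} := [ffun j => Ordinal (lt i j)].
have f_inj : injective f.
  move=> i i' /ffunP e.
  have agree c : c \in conjs alpha -> nu i c = nu i' c.
    move=> cx; have ltc : (index c (conjs alpha) < m)%N by rewrite index_mem.
    have := congr1 val (e (Ordinal ltc)); rewrite !ffunE /= nth_index //.
    move/(congr1 (nth 0 (conjs alpha))); rewrite !nth_index ?mem_conjs_aut //.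
  have fx : fixes (algC_invaut (nu i') \o nu i).
    by move=> c cx /=; rewrite agree // algC_autK.
  have := fz _ fx => /(congr1 (nu i')) /=; rewrite algC_invautK !Hnu => /eqP.
  by rewrite nth_uniq ?conjs_uniq ?ltn_ord // => /eqP/val_inj.
by have := leq_card f f_inj; rewrite card_ord.
Qed.

End FixedField.

(** * Values that are attained and their finiteness *)

Section DominantValues.
Variables (R : realType) (iota : {rmorphism algC -> R[i]}) (alpha : algC).
Local Notation A := (absC iota).
Let aA : absval A := absC_absval iota.
Local Notation in_fixed := (in_fixed alpha).

(** Apart from 0, these are the weak Perron numbers that come from $K_\alpha$ through [iota]; the
    last clause at the identity forces [t] to be non-negative. *)
Definition dominant_value (t : R) : Prop := exists z,
  [/\ iota z = t%:C%C, in_fixed z, z \in Aint &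
      forall nu : {rmorphism algC -> algC}, A (nu z) <= t].

Lemma dominant1 : dominant_value 1.
Proof.
exists 1; split; rewrite ?rmorph1 ?rpred1 //.
  by move=> nu _; rewrite rmorph1.
by move=> nu; rewrite rmorph1 (av1 aA).
Qed.

Lemma dominantM s t : dominant_value s -> dominant_value t -> dominant_value (s * t).
Proof.
move=> [y [ys fy iy by_]] [z [zt fz iz bz]]; exists (y * z); split.
- by rewrite rmorphM ys zt -rmorphM.
- exact: in_fixedM.
- exact: rpredM.
- by move=> nu; rewrite rmorphM (avM aA) ler_pM ?(av_ge0 aA).
Qed.

Lemma dominant_prod (I : Type) (r : seq I) (f : I -> R) :
  (forall i, dominant_value (f i)) -> dominant_value (\prod_(i <- r) f i).
Proof. by move=> h; elim/big_ind: _ => //; [exact: dominant1|exact: dominantM]. Qed.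

Lemma coef_prod_XsubC_bound (s : seq algC) i :
  A (\prod_(z <- s) ('X - z%:P))`_i <= \prod_(z <- s) (1 + A z).
Proof.
elim: s i => [|z s IH] i.
  by rewrite !big_nil coef1; case: (i == 0)%N; rewrite ?(av1 aA) ?(av0 aA) ?ler01.
rewrite !big_cons mulrBl coefB mulrC coefMX coefCM mulrDl mul1r.
have p0 : 0 <= \prod_(z <- s) (1 + A z) by rewrite prodr_ge0 // => y _; rewrite addr_ge0 ?(av_ge0 aA).
apply: le_trans (avB aA _ _) _; apply: lerD.
  by case: ifP => _; rewrite ?(av0 aA).
by rewrite (avM aA) ler_wpM2l ?(av_ge0 aA).
Qed.

Lemma shifted_absz (a : int) (C : nat) : `|a| <= C%:Z ->
  (absz (a + C%:Z)%R < (C + C).+1)%N /\ (absz (a + C%:Z)%R)%:Z - C%:Z = a.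
Proof. by rewrite ler_norml => /andP[]; lia. Qed.

(** Northcott's argument: the minimal polynomial has integer coefficients, its degree is bounded by
    [in_fixed_conjs], and its roots are bounded by [B] because [t] bounds all conjugates. *)
Lemma dominant_finite B : exists l : seq R,
  forall t, dominant_value t -> t <= B -> t \in l.
Proof.
pose m := size (conjs alpha); pose D := #|{ffun 'I_m -> 'I_m}|.
pose C := Num.bound ((1 + Num.max 0 B) ^+ D).
have B0 : 0 <= Num.max 0 B by rewrite le_max lexx.
(* Integers between [-C] and [C] are coded by a shift of [C], so that the candidate polynomials are
   indexed by a finite type. *)
pose Pf (f : {ffun 'I_D.+1 -> 'I_(C + C).+1}) : {poly int} :=
  \poly_(i < D.+1) ((f (inord i))%:Z - C%:Z).
pose roots f := sval (closed_field_poly_normal (pZtoC (Pf f))).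
exists (flatten [seq [seq complex.Re (iota z) | z <- roots f] | f <- enum {ffun 'I_D.+1 -> 'I_(C + C).+1}]).
move=> t [z [zt fz iz bz]] tB.
suff [f [f0 rf]] : exists f, Pf f != 0 /\ root (pZtoC (Pf f)) z.
  apply/flattenP; exists [seq complex.Re (iota z) | z <- roots f].
    by apply: map_f; rewrite mem_enum.
  have -> : t = complex.Re (iota z) by rewrite zt.
  apply: (map_f (fun z => complex.Re (iota z))); move: rf; rewrite /roots; case: closed_field_poly_normal => s /= {1}->.
  rewrite rootZ ?root_prod_XsubC // lead_coef_eq0.
  apply: contra f0 => /eqP e; apply/eqP/(map_inj_poly (@intr_inj algC)); by rewrite ?rmorph0.
have /floorpP[P DP] : minCpoly z \is a polyOver Num.int by [].
have szP : (size P <= D.+1)%N.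
  have -> : size P = size (minCpoly z).
    by rewrite DP size_map_inj_poly ?rmorph0 //; exact: intr_inj.
  by rewrite size_conjs ltnS in_fixed_conjs.
have P0 : P != 0.
  by apply: contraFneq (minCpoly_eq0 z) => P0; rewrite DP P0 rmorph0.
have cP (i : nat) : `|P`_i| <= C%:Z.
  rewrite -(ler_int R) intr_norm -(absC_int iota).
  have -> : (P`_i)%:~R = (minCpoly z)`_i by rewrite DP coef_map.
  rewrite minCpoly_conjs; apply: le_trans (coef_prod_XsubC_bound _ _) _.
  apply: ltW; apply: le_lt_trans (archi_boundP _); last by rewrite exprn_ge0 // addr_ge0.
  apply: (@le_trans _ _ ((1 + Num.max 0 B) ^+ size (conjs z))).
    have -> : (1 + Num.max 0 B) ^+ size (conjs z) = \prod_(y <- conjs z) (1 + Num.max 0 B).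
      by rewrite big_const_seq count_predT iter_mulr_1.
    rewrite big_seq [leRHS]big_seq; apply: ler_prod => y /conj_autP[nu <-].
    apply/andP; split; first by rewrite addr_ge0 ?(av_ge0 aA).
    by rewrite lerD2l le_max (le_trans (bz nu) tB) orbT.
  by rewrite ler_weXn2l ?lerDl // in_fixed_conjs.
pose f : {ffun 'I_D.+1 -> 'I_(C + C).+1} := [ffun i : 'I_D.+1 => inord (absz (P`_i + C%:Z))].
have fP : Pf f = P.
  apply/polyP => i; rewrite coef_poly; case: ltnP => h; last by rewrite nth_default // (leq_trans szP).
  have -> : inord i = Ordinal h by apply: val_inj; rewrite /= inordK.
  have [lt e] := shifted_absz (cP i).
  by rewrite ffunE inordK.
by exists f; rewrite fP P0 -DP root_minCpoly.
Qed.

End DominantValues.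

(** * Mahler measures of radicals *)

Section Radicals.
Variables (R : realType) (iota : {rmorphism algC -> R[i]}) (alpha : algC).
Local Notation A := (absC iota).
Let aA : absval A := absC_absval iota.

(** For an arbitrary [iota] the conjugation of [algC] need not match that of [R[i]]. The latter
    permutes the roots of rational polynomials, so it preserves the image of [iota] and can be
    pulled back. *)
Lemma conj_aut_exists : exists c : {rmorphism algC -> algC},
  forall y, iota (c y) = (iota y)^*%C.
Proof.
have ex y : exists z, iota z = (iota y)^*%C.
  have : root (map_poly iota (minCpoly y)) (iota y)^*%C.
    have [p [-> _] dp] := minCpolyP y.
    rewrite -complex_root_conj -!map_poly_comp.
    have E : map_poly (conjc \o (iota \o ratr)) p = map_poly (iota \o ratr) p.
      by apply: eq_map_poly => a /=; rewrite !fmorph_rat.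
    by rewrite E map_poly_comp fmorph_root dp.
  rewrite minCpoly_conjs map_prod_XsubC -(big_map iota xpredT (fun z => 'X - z%:P)).
  by rewrite root_prod_XsubC => /mapP[z _ ->]; exists z.
have [c Hc] := choice ex.
have ca : zmod_morphism c.
  by move=> y z; apply: (fmorph_inj iota); rewrite rmorphB !Hc !rmorphB.
have cm : monoid_morphism c.
  split=> [|y z]; apply: (fmorph_inj iota); rewrite ?rmorphM !Hc ?rmorphM //.
  by rewrite !rmorph1.
pose caM := GRing.isZmodMorphism.Build algC algC c ca.
pose cmM := GRing.isMonoidMorphism.Build algC algC c cm.
pose cRM : {rmorphism algC -> algC} := HB.pack c caM cmM.
by exists cRM.
Qed.

Lemma normc_conjc (z : R[i]) : Normc.normc z^*%C = Normc.normc z.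
Proof. by case: z => a b /=; rewrite sqrrN. Qed.

Lemma if_max1_bounds (b : bool) (x : R) : 0 <= x ->
  0 <= (if b then x else 1) <= Num.max 1 x.
Proof. by move=> x0; case: b; rewrite ?x0 ?ler01 le_max lexx ?orbT. Qed.

Lemma prod_max1_gt1 (s : seq algC) :
  \prod_(z <- s) Num.max 1 (A z) = \prod_(z <- s | 1 < A z) A z.
Proof.
rewrite [RHS]big_mkcond; apply: eq_bigr => z _.
by case: ltP.
Qed.

(* Up to sign the Mahler measure is the product of the leading coefficient and
   of the conjugates outside the unit disc; an automorphism preserving absolute
   values of conjugates permutes the latter. *)
Lemma mahler_radical_dominant gamma e : (0 < e)%N -> in_fixed alpha (gamma ^+ e) ->
  dominant_value iota alpha (mahler R gamma).
Proof.
move=> e0 fg; have [q cq Dq] := primitive_minpoly gamma.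
have a0 := lead_primitive_gt0 cq; pose a : algC := (lead_coef q)%:~R.
have aR : A a = (lead_coef q)%:~R by rewrite absC_int gtr0_norm // ltr0z.
pose z0 := a * \prod_(g <- conjs gamma | 1 < A g) g.
have mE : mahler R gamma = A z0.
  by rewrite (mahler_formula iota cq Dq) (avM aA) aR (av_prod aA) prod_max1_gt1.
have z0_aut (nu : {rmorphism algC -> algC}) :
    (forall g, g \in conjs gamma -> A (nu g) = A g) -> nu z0 = z0.
  move=> h; rewrite /z0 rmorphM rmorph_int rmorph_prod; congr (_ * _).
  rewrite big_seq_cond [RHS]big_seq_cond.
  rewrite (eq_bigl (fun g => (g \in conjs gamma) && (1 < A (nu g)))); last first.
    by move=> g; case: (boolP (g \in conjs gamma)) => //= gx; rewrite h.
  rewrite -big_seq_cond -[RHS]big_seq_cond -(big_map nu (fun g => 1 < A g) id).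
  exact: perm_big (map_conjs_aut nu gamma).
have z0_fixed : in_fixed alpha z0.
  move=> nu hn; apply: z0_aut => g /conj_autP[mu <-].
  have hA : A (nu (mu gamma)) ^+ e = A (mu gamma) ^+ e.
    by rewrite -!(avX aA) -!rmorphXn (in_fixed_aut mu fg).
  by apply: (pexpIrn e0); rewrite ?nnegrE ?(av_ge0 aA).
(* At each prime the selected conjugates contribute at most the full Gauss norm, which cancels
   against the size of [a]. *)
have z0_int : z0 \in Aint.
  apply: (@locally_integral_Aint R) => p w pp aw uw wp.
  have G := gauss_norm_primitive pp aw uw wp cq; rewrite minCpoly_conjs in Dq.
  have {}G := G _ Dq.
  apply: (@le_trans _ _ (w a * \prod_(g <- conjs gamma) Num.max 1 (w g))).
    rewrite (avM aw) ler_wpM2l ?(av_ge0 aw) // (av_prod aw) big_mkcond.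
    by apply: ler_prod => g _; exact: if_max1_bounds (av_ge0 aw _).
  rewrite G /a -ratr_int wp padic_abs_int ?gt_eqF // mulVf //.
  by rewrite expf_neq0 // pnatr_eq0 -lt0n prime_gt0.
(* [nu] may move a selected conjugate into the unit disc, so its image contributes at most its
   factor in the full product of maxima. *)
have z0_bound (nu : {rmorphism algC -> algC}) : A (nu z0) <= A z0.
  rewrite -mE (mahler_formula iota cq Dq) rmorphM (avM aA) rmorph_int aR.
  rewrite ler_wpM2l ?ler0z ?(ltW a0) // rmorph_prod (av_prod aA).
  rewrite -[leRHS](perm_big _ (map_conjs_aut nu gamma)) big_map big_mkcond.
  by apply: ler_prod => g _; exact: if_max1_bounds (av_ge0 aA _).
have [c Hc] := conj_aut_exists.
have z0_real : (iota z0)^*%C = iota z0.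
  by rewrite -Hc z0_aut // => g _; rewrite /absC Hc normc_conjc.
have [r Dr] : exists r : R, iota z0 = r%:C%C.
  by case: (iota z0) z0_real => u v [vE]; exists u; have -> : v = 0 by lra.
have rA : A z0 = `|r| by rewrite /absC Dr /= expr0n /= addr0 sqrtr_sqr.
rewrite mE; have [r0|r0] := lerP 0 r.
  by exists z0; split=> //; rewrite rA ger0_norm.
exists (- z0); split.
- by rewrite rmorphN Dr -rmorphN rA ltr0_norm.
- exact: in_fixedN.
- by rewrite rpredN.
- by move=> nu; rewrite rmorphN (avN aA).
Qed.

End Radicals.

(** * Replacing a factor by a radical of its relative norm *)

Section RelativeNorm.
Variables (R : realType) (iota : {rmorphism algC -> R[i]}) (alpha beta : algC).
Local Notation A := (absC iota).
Let aA : absval A := absC_absval iota.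
Implicit Types (mu nu : {rmorphism algC -> algC}).

Let d := size (conjs beta).
Let Z (i : 'I_d) : algC := (conjs beta)`_i.

Let Z_conj i : Z i \in conjs beta. Proof. exact: mem_nth. Qed.

Let Z_inj : injective Z.
Proof.
move=> i j /eqP; rewrite nth_uniq ?conjs_uniq ?ltn_ord // => /eqP; exact: val_inj.
Qed.

Let Z_surj z : z \in conjs beta -> exists i, Z i = z.
Proof.
move=> zb; have lt : (index z (conjs beta) < d)%N by rewrite index_mem.
by exists (Ordinal lt); rewrite /Z nth_index.
Qed.

Let act nu : exists2 f : 'I_d -> 'I_d, injective f & forall i, Z (f i) = nu (Z i).
Proof.
have ex i : exists j, Z j = nu (Z i) by apply: Z_surj; rewrite mem_conjs_aut.
have [f Hf] := choice ex; exists f => // i j e.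
by apply: Z_inj; apply: (fmorph_inj nu); rewrite -!Hf e.
Qed.

Let rl : rel 'I_d := fun i j => `[< exists nu, fixes alpha nu /\ nu (Z i) = Z j >].

Let rl_refl i : rl i i. Proof. by apply/asboolP; exists idfun. Qed.

Let rl_sym i j : rl i j -> rl j i.
Proof.
move=> /asboolP[nu [fn e]]; apply/asboolP; exists (algC_invaut nu).
by split; [exact: fixes_inv|rewrite -e /= algC_autK].
Qed.

Let rl_trans i j k : rl i j -> rl j k -> rl i k.
Proof.
move=> /asboolP[nu [fn e]] /asboolP[mu [fm e']]; apply/asboolP; exists (mu \o nu).
by split; [exact: fixes_comp|rewrite /= e e'].
Qed.

Let rl_equiv : {in [set: 'I_d] & &, equivalence_rel rl}.
Proof.
move=> i j k _ _ _; split; first exact: rl_refl.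
move=> ij; apply/idP/idP => h; last exact: rl_trans ij h.
exact: rl_trans (rl_sym ij) h.
Qed.

Let P := equivalence_partition rl [set: 'I_d].
Let partP : finset.partition P [set: 'I_d]. Proof. exact: equivalence_partitionP. Qed.
Let block i : {set 'I_d} := [set j | rl i j].

Let block_P i : block i \in P.
Proof.
by apply/imsetP; exists i => //; apply/setP => j; rewrite !inE.
Qed.

Let P_block B : B \in P -> exists i, B = block i.
Proof. by move=> /imsetP[i _ ->]; exists i; apply/setP => j; rewrite !inE. Qed.

(** Since H is normal, every automorphism carries H-orbits to H-orbits. *)
Let rl_act nu f i j : (forall i, Z (f i) = nu (Z i)) -> rl (f i) (f j) = rl i j.
Proof.
move=> Hf; apply/asboolP/asboolP => -[mu [fm e]]; rewrite ?Hf in e *.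
  exists (algC_invaut nu \o mu \o nu); split; first exact: fixes_conj.
  by rewrite /= e algC_autK.
have fx := fixes_conj (algC_invaut nu) fm.
exists (algC_invaut (algC_invaut nu) \o mu \o algC_invaut nu); split=> //.
have invK y : algC_invaut (algC_invaut nu) y = nu y.
  by apply: (fmorph_inj (algC_invaut nu)); rewrite /= algC_invautK algC_autK.
by rewrite /= algC_autK e invK.
Qed.

Let act_block nu f i : injective f -> (forall i, Z (f i) = nu (Z i)) ->
  f @: block i = block (f i).
Proof.
move=> f_inj Hf; have [g fK gK] := injF_bij f_inj.
apply/setP => j; rewrite -[j]gK mem_imset // !inE.
by rewrite (rl_act _ _ Hf).
Qed.

Let act_P nu f (B : {set 'I_d}) : injective f -> (forall i, Z (f i) = nu (Z i)) ->
  (f @: B \in P) = (B \in P).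
Proof.
move=> f_inj Hf; have [g fK gK] := injF_bij f_inj.
apply/idP/idP => [/P_block[i e]|/P_block[i ->]]; last by rewrite (act_block _ f_inj Hf) block_P.
have -> : B = block (g i); last exact: block_P.
by apply: (imset_inj f_inj); rewrite e (act_block _ f_inj Hf) gK.
Qed.

Let nm (B : {set 'I_d}) : algC := \prod_(i in B) Z i.

Let nm_act nu f (B : {set 'I_d}) : injective f -> (forall i, Z (f i) = nu (Z i)) -> nu (nm B) = nm (f @: B).
Proof.
move=> f_inj Hf; rewrite /nm big_imset /=; last by move=> ? ? _ _; exact: f_inj.
by rewrite rmorph_prod; apply: eq_bigr => i _; rewrite Hf.
Qed.

Let i0 : 'I_d := sval (cid (Z_surj (conjs_id beta))).
Let Zi0 : Z i0 = beta := svalP (cid (Z_surj (conjs_id beta))).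

Let e := #|block i0|.
Let e_gt0 : (0 < e)%N. Proof. by apply/card_gt0P; exists i0; rewrite inE. Qed.

Let nm_fixed B : B \in P -> in_fixed alpha (nm B).
Proof.
move=> /P_block[i ->] nu hn; have [f f_inj Hf] := act nu.
rewrite (nm_act _ f_inj Hf) (act_block _ f_inj Hf); congr nm.
apply/setP => j; rewrite !inE.
have h : rl i (f i) by apply/asboolP; exists nu.
by apply/idP/idP; [exact: rl_trans|exact: (rl_trans (rl_sym h))].
Qed.

(** All orbits of conjugates of [beta] are taken, not only that of [beta]: automorphisms permute
    them, which makes [F] rational. *)
Let F : {poly algC} := \prod_(B in P) ('X - (nm B)%:P).

Let F_rat : exists r : {poly rat}, F = pQtoC r.
Proof.
apply: fixed_poly_rat => nu; have [f f_inj Hf] := act nu.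
rewrite /F rmorph_prod /= [RHS](reindex_inj (imset_inj f_inj)) /=.
apply: eq_big => [B|B _]; first by rewrite (act_P _ f_inj Hf).
by rewrite map_polyXsubC /= (nm_act _ f_inj Hf).
Qed.

Let prod_blocks (G : 'I_d -> R) :
  \prod_(B in P) \prod_(i in B) G i = \prod_i G i.
Proof.
rewrite -big_trivIset; last by case/and3P: partP.
by have /and3P[/eqP -> _ _] := partP; apply: eq_bigl => i; rewrite inE.
Qed.

Let prod_Z (g : algC -> R) : \prod_i g (Z i) = \prod_(z <- conjs beta) g z.
Proof. by rewrite (big_nth 0) big_mkord. Qed.

Lemma max1_prod_le (I : Type) (s : seq I) (Q : pred I) (G : I -> R) :
  (forall i, 0 <= G i) ->
  Num.max 1 (\prod_(i <- s | Q i) G i) <= \prod_(i <- s | Q i) Num.max 1 (G i).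
Proof.
move=> G0; rewrite ge_max prod_max1_ge1 /=; apply: ler_prod => i _.
by rewrite G0 le_max lexx orbT.
Qed.

Let prod_max_nm (w : algC -> R) : absval w ->
  \prod_(B in P) Num.max 1 (w (nm B)) <= \prod_(z <- conjs beta) Num.max 1 (w z).
Proof.
move=> aw; rewrite -prod_Z -prod_blocks; apply: ler_prod => B _.
rewrite le_max ler01 /= (av_prod aw); apply: max1_prod_le => i.
exact: av_ge0.
Qed.

Let gamma : algC := e.-root (nm (block i0)).

Let gammaX : gamma ^+ e = nm (block i0). Proof. exact: rootCK. Qed.

(** All [e] roots of ['X^e - b] have the same size, and the [e]-th power of that size is the size of
    [b]. *)
Let nth_roots b : exists2 s : seq algC,
  'X^e - b%:P = \prod_(z <- s) ('X - z%:P) &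
  \prod_(z <- s) Num.max 1 (A z) = Num.max 1 (A b).
Proof.
have [s Ds] := closed_field_poly_normal ('X^e - b%:P).
have m1 : 'X^e - b%:P \is monic by rewrite monicXnsubC.
rewrite (monicP m1) scale1r in Ds; exists s => //.
have zs z : z \in s -> z ^+ e = b.
  by rewrite -root_prod_XsubC -Ds /root !hornerE subr_eq0 => /eqP.
have sz : size s = e.
  by have := congr1 (fun p : {poly algC} => size p) Ds; rewrite size_XnsubC // size_prod_XsubC => -[].
have M0 (x : R) : 0 <= Num.max 1 x by rewrite le_max ler01.
apply: (pexpIrn e_gt0); rewrite ?nnegrE ?prodr_ge0 //.
rewrite -prodrXl (eq_big_seq (fun=> Num.max 1 (A b))); last first.
  by move=> z /zs zb; rewrite max1X ?(av_ge0 aA) // -(avX aA) zb.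
by rewrite big_const_seq count_predT sz iter_mulr_1.
Qed.

(** With [a] the leading coefficient for [beta], the polynomial $aF(X^e)$ vanishes at [gamma], and
    passing to orbit norms and then to their roots does not increase the product of maxima.
    [mahler_le] applies once $aF$ is integral. *)
Let mahler_gamma : mahler R gamma <= mahler R beta.
Proof.
have [q cq Dq] := primitive_minpoly beta; have a0 := lead_primitive_gt0 cq.
have [r Dr] := F_rat; set a := lead_coef q in a0 *.
(* At each prime the coefficients of [F] are bounded by the Gauss norm for [beta], which is the
   inverse of the size of [a]. *)
have [|P1 DP1] := @locally_integral_poly R (a%:~R *: r).
  move=> i p w pp aw uw wp.
  have -> : ratr ((a%:~R *: r)`_i) = a%:~R * F`_i.
    by rewrite coefZ rmorphM /= ratr_int Dr coef_map.
  have G := gauss_norm_primitive pp aw uw wp cq; rewrite minCpoly_conjs in Dq.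
  have {}G := G _ Dq.
  apply: (@le_trans _ _ (w a%:~R * \prod_(g <- conjs beta) Num.max 1 (w g))).
    rewrite (avM aw) ler_wpM2l ?(av_ge0 aw) //; apply: le_trans (prod_max_nm aw).
    have := coef_prod_XsubC_le aw uw [seq nm B | B <- enum P] i.
    by rewrite !big_map !big_enum.
  rewrite G -ratr_int wp padic_abs_int ?gt_eqF // mulVf //.
  by rewrite expf_neq0 // pnatr_eq0 -lt0n prime_gt0.
pose G := P1 \Po 'X^e.
have [rts rts_prod rts_max] : exists2 rts : algC -> seq algC,
    forall b, 'X^e - b%:P = \prod_(z <- rts b) ('X - z%:P) &
    forall b, \prod_(z <- rts b) Num.max 1 (A z) = Num.max 1 (A b).
  have ex b : exists s : seq algC, 'X^e - b%:P = \prod_(z <- s) ('X - z%:P) /\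
      \prod_(z <- s) Num.max 1 (A z) = Num.max 1 (A b).
    by have [s] := nth_roots b; exists s.
  by have [rts H] := choice ex; exists rts => b; case: (H b).
pose s := flatten [seq rts (nm B) | B <- enum P].
have DG : pZtoC G = a%:~R *: \prod_(z <- s) ('X - z%:P).
  rewrite /G map_comp_poly /= map_polyXn -pQtoC_pZtoQ -DP1 linearZ /= ratr_int -Dr.
  rewrite comp_polyZ; congr (_ *: _); rewrite /F rmorph_prod /= /s big_flatten big_map big_enum /=.
  apply: eq_bigr => B _; rewrite -rts_prod comp_polyB comp_polyX comp_polyC //.
have lG : lead_coef G = a.
  apply: (@intr_inj algC); have := congr1 lead_coef DG.
  rewrite lead_coef_map_inj ?rmorph0 //; last exact: intr_inj.
  by rewrite lead_coefZ (monicP (monic_prod_XsubC _ _ _)) mulr1.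
have G0 : G != 0 by rewrite -lead_coef_eq0 lG gt_eqF.
have gs : gamma \in s.
  apply/flattenP; exists (rts (nm (block i0))).
    by apply: (map_f (fun B => rts (nm B))); rewrite mem_enum block_P.
  by rewrite -root_prod_XsubC -rts_prod /root !hornerE gammaX subrr.
have := @mahler_le R iota gamma G s G0; rewrite lG => /(_ DG gs)/le_trans; apply.
rewrite (mahler_formula iota cq Dq) gtr0_norm ?ltr0z // ler_wpM2l ?ler0z ?(ltW a0) //.
apply: le_trans (prod_max_nm aA).
rewrite /s big_flatten big_map big_enum /=.
by under eq_bigr => B _ do rewrite rts_max.
Qed.

Lemma relative_norm_radical : beta != 0 -> exists (g : algC) (O : seq algC),
  [/\ (0 < size O)%N /\ g ^+ size O = \prod_(z <- O) z,
      in_fixed alpha (\prod_(z <- O) z),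
      forall z, z \in O -> exists2 nu, fixes alpha nu & nu beta = z,
      mahler R g <= mahler R beta & g != 0].
Proof.
move=> b0; pose O := [seq Z i | i <- enum (block i0)].
have sO : size O = e by rewrite size_map -cardE.
have pO : \prod_(z <- O) z = nm (block i0) by rewrite big_map big_enum.
have n0 : nm (block i0) != 0.
  apply/prodf_neq0 => i _; have [nu <-] := conj_autP (Z_conj i).
  by rewrite fmorph_eq0.
exists gamma, O; rewrite sO pO; split=> //.
- exact: nm_fixed.
- move=> z zO; have [i iB zi] := mapP zO; move: iB; rewrite mem_enum inE.
  by move=> /asboolP[nu [fn e1]]; exists nu; rewrite // zi -e1 Zi0.
- by apply: contraNneq n0 => g0; rewrite -gammaX g0 expr0n eqn0Ngt e_gt0.
Qed.

End RelativeNorm.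

(* The automorphisms fixing the conjugates of alpha act on a finite set of
   algebraic numbers through a finite group of permutations. *)
Lemma averaging_family alpha (zs : seq algC) :
  exists (I : finType) (nu : I -> {rmorphism algC -> algC}),
  [/\ (0 < #|I|)%N, forall i, fixes alpha (nu i) &
      forall (mu : {rmorphism algC -> algC}) z, fixes alpha mu -> z \in zs ->
        \prod_i nu i (mu z) = \prod_i nu i z].
Proof.
pose ys := undup (flatten (map conjs zs)); pose m := size ys.
pose Y (i : 'I_m) := ys`_i.
have uy : uniq ys by exact: undup_uniq.
have Y_inj : injective Y by move=> i j /eqP; rewrite nth_uniq ?ltn_ord // => /eqP/val_inj.
have ys_aut (nu : {rmorphism algC -> algC}) y : y \in ys -> nu y \in ys.
  rewrite !mem_undup => /flattenP[_ /mapP[z zz ->] yz].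
  by apply/flattenP; exists (conjs z); [apply: map_f|rewrite mem_conjs_aut].
have Y_surj y : y \in ys -> exists i, Y i = y.
  move=> yy; have lt : (index y ys < m)%N by rewrite index_mem.
  by exists (Ordinal lt); rewrite /Y nth_index.
have act (nu : {rmorphism algC -> algC}) : exists s : {perm 'I_m}, forall i, Y (s i) = nu (Y i).
  have ex i : exists j, Y j = nu (Y i) by apply/Y_surj/ys_aut/mem_nth.
  have [f Hf] := choice ex.
  have f_inj : injective f.
    by move=> i j e; apply: Y_inj; apply: (fmorph_inj nu); rewrite -!Hf e.
  by exists (perm f_inj) => i; rewrite permE.
pose good (s : {perm 'I_m}) := `[< exists2 nu : {rmorphism algC -> algC}, fixes alpha nu & forall i, Y (s i) = nu (Y i) >].
have ex (s : {s | good s}) : exists nu : {rmorphism algC -> algC},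
    fixes alpha nu /\ forall i, Y (val s i) = nu (Y i).
  by case: s => s /= /asboolP[nu fn Hn]; exists nu.
have [nu Hnu] := choice ex.
have good1 : good 1%g by apply/asboolP; exists idfun => // i; rewrite perm1.
exists {s | good s}, nu; split=> [|i|mu z fm zz].
- by apply/card_gt0P; exists (exist good 1%g good1).
- by case: (Hnu i).
have [i Yi] : exists i, Y i = z.
  by apply: Y_surj; rewrite mem_undup; apply/flattenP; exists (conjs z); [apply: map_f|apply: conjs_id].
have [t Ht] := act mu.
have goodM s : good s -> good (t * s)%g.
  move=> /asboolP[nu' fn Hn]; apply/asboolP; exists (nu' \o mu); first exact: fixes_comp.
  by move=> j; rewrite permM Hn Ht.
(* [nu (h s)] and [nu s \o mu] may differ as automorphisms, but they agree on [ys]. *)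
pose h (s : {s | good s}) : {s | good s} := exist good _ (goodM _ (valP s)).
have h_inj : injective h by move=> s s' /(congr1 val) /= /mulgI/val_inj.
rewrite [RHS](reindex_inj h_inj) /=; apply: eq_bigr => s _.
have [_ H1] := Hnu s; have [_ H2] := Hnu (h s).
by rewrite -Yi -H2 -Ht -H1 /= permM.
Qed.

(** * The infimum is attained *)

Section Attained.
Variables (R : realType) (iota : {rmorphism algC -> R[i]}) (alpha : algC).
Hypothesis alpha0 : alpha != 0.

Lemma radical_factorization N (a : 'I_N -> algC) :
  (forall n, a n != 0) -> alpha = \prod_(n < N) a n ->
  exists (g : 'I_N -> algC) (zeta : algC),
  [/\ alpha = zeta * \prod_(n < N) g n, forall n, g n != 0,
      forall n, exists2 e, (0 < e)%N & in_fixed alpha (g n ^+ e),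
      forall n, mahler R (g n) <= mahler R (a n) &
      exists2 k, (0 < k)%N & zeta ^+ k = 1].
Proof.
move=> a0 Da.
have ex n : exists gO : algC * seq algC,
    [/\ (0 < size gO.2)%N /\ gO.1 ^+ size gO.2 = \prod_(z <- gO.2) z,
      in_fixed alpha (\prod_(z <- gO.2) z),
      forall z, z \in gO.2 -> exists2 nu : {rmorphism algC -> algC}, fixes alpha nu & nu (a n) = z,
      mahler R gO.1 <= mahler R (a n) & gO.1 != 0].
  by have [g [O H]] := relative_norm_radical iota alpha (a0 n); exists (g, O).
have [gO H] := choice ex; pose g n := (gO n).1; pose O n := (gO n).2.
pose e n := size (O n).
have e0 n : (0 < e n)%N by have [[]] := H n.
have gX n : g n ^+ e n = \prod_(z <- O n) z by have [[]] := H n.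
have g0 n : g n != 0 by have [] := H n.
have gp0 : \prod_n g n != 0 by apply/prodf_neq0.
exists g, (alpha / \prod_n g n); split=> //.
- by rewrite divfK.
- by move=> n; exists (e n) => //; rewrite gX; have [] := H n.
- by move=> n; have [] := H n.
have [I [nu [I0 fnu avg]]] := averaging_family alpha [seq a n | n <- enum 'I_N].
have avg_n n mu : fixes alpha mu -> \prod_i nu i (mu (a n)) = \prod_i nu i (a n).
  by move=> fm; apply: avg => //; apply: map_f; rewrite mem_enum.
pose M n := \prod_i nu i (a n).
(* Both sides are the product of [nu i z] over all [i] and all [z] in the orbit: each [z] has the
   same average [M n] as [a n], while each [nu i] fixes the orbit product. *)
have MX n : M n ^+ e n = (g n ^+ e n) ^+ #|I|.
  have -> : (g n ^+ e n) ^+ #|I| = \prod_(z <- O n) \prod_i nu i z.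
    rewrite exchange_big /= gX -[LHS]prodr_const; apply: eq_bigr => i _.
    by rewrite -rmorph_prod; have [_ ->] := H n.
  rewrite (eq_big_seq (fun=> M n)).
    by rewrite big_const_seq count_predT iter_mulr_1.
  by move=> z zO; have [_ _ /(_ z zO)[mu fm <-] _ _] := H n; rewrite avg_n.
have Mprod : \prod_n M n = alpha ^+ #|I|.
  rewrite exchange_big /= -[RHS]prodr_const; apply: eq_bigr => i _.
  by rewrite -rmorph_prod -Da fnu // conjs_id.
(* A common multiple of the [e n], so that [MX] can be used for all factors at once. *)
pose E := (\prod_n e n)%N.
have E0 : (0 < E)%N by apply: prodn_gt0.
exists (#|I| * E)%N; first by rewrite muln_gt0 I0.
rewrite expr_div_n [in X in X / _]exprM -Mprod -!prodrXl -prodf_div big1 // => n _.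
have /dvdnP[c ->] : (e n %| E)%N by rewrite /E (bigD1 n) //= dvdn_mulr.
have -> : M n ^+ (c * e n) = g n ^+ (#|I| * (c * e n)).
  by rewrite mulnC exprM MX -!exprM; congr (_ ^+ _); ring.
by rewrite divff // expf_neq0.
Qed.

Let values : set R := [set y : R | exists N (a : 'I_N -> algC),
  [/\ (0 < N)%N, forall n, a n != 0, alpha = \prod_(n < N) a n
    & y = \prod_(n < N) mahler R (a n)]]%classic.

Let values_dominant y : values y ->
  exists2 t, values t /\ dominant_value iota alpha t & t <= y.
Proof.
move=> [N [a [N0 a0 Da ->]]].
have [g [zeta [Dg g0 gK gle [k k0 zk]]]] := radical_factorization a0 Da.
have z0 : zeta != 0 by apply: contra_eq_neq Dg => ->; rewrite mul0r.
(* The root of unity is put in at index 0, so that the product is exactly [alpha]. *)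
pose f (i : 'I_N.+1) := oapp g zeta (unlift ord0 i).
have f_prod (T : comRingType) (h : algC -> T) :
    \prod_(i < N.+1) h (f i) = h zeta * \prod_(n < N) h (g n).
  rewrite big_ord_recl {1}/f unlift_none; congr (_ * _).
  by apply: eq_bigr => n _; rewrite /f liftK.
exists (\prod_(i < N.+1) mahler R (f i)); last first.
  rewrite (f_prod _ (mahler R)) -[leRHS]mul1r ler_pM ?mahler_ge0 //.
  - by apply: prodr_ge0 => n _; exact: mahler_ge0.
  - exact: mahler_unity_root zk.
  - by apply: ler_prod => n _; rewrite (mahler_ge0 iota) gle.
split.
  exists N.+1, f; split=> // [i|]; last by rewrite (f_prod _ id).
  by rewrite /f; case: (unlift ord0 i) => /=.
apply: dominant_prod => i; rewrite /f; case: (unlift ord0 i) => [n|] /=.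
  by have [e e0 fe] := gK n; exact: mahler_radical_dominant fe.
apply: mahler_radical_dominant k0 _; rewrite zk => nu _; exact: rmorph1.
Qed.

Let seq_min (l : seq R) : l != [::] -> exists2 t, t \in l & forall u, u \in l -> t <= u.
Proof.
elim: l => // x l IH _; have [->|l0] := eqVneq l [::].
  by exists x; rewrite ?mem_head // => u; rewrite inE => /eqP->.
have [t tl Ht] := IH l0; have [xt|tx] := lerP x t.
  exists x; first exact: mem_head.
  by move=> u; rewrite inE => /orP[/eqP-> //|/Ht]; exact: le_trans.
exists t; first by rewrite inE tl orbT.
by move=> u; rewrite inE => /orP[/eqP->|/Ht //]; exact: ltW.
Qed.

(** By [values_dominant] the infimum may be taken over dominant values alone. Those up to a first
    one [t0] form a finite set, and larger ones cannot lower the minimum. *)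
Lemma metric_mahler_dominant : dominant_value iota alpha (metric_mahler R alpha).
Proof.
have ex0 : values (mahler R alpha).
  by exists 1%N, (fun=> alpha); split; rewrite ?big_ord1.
have [t0 [v0 d0] _] := values_dominant ex0.
have [l Hl] := dominant_finite iota alpha t0.
(* [l] may contain numbers that are not values; without the filter its minimum could lie below the
   infimum. *)
pose l' := [seq t <- l | `[< values t /\ dominant_value iota alpha t >]].
have memE t : values t -> dominant_value iota alpha t -> t <= t0 -> t \in l'.
  by move=> vt dt le; rewrite mem_filter (Hl t dt le) andbT; apply/asboolP.
have t0l := memE _ v0 d0 (lexx t0).
have [|t tl tmin] := seq_min (l := l'); first by apply: contraTneq t0l => ->.
have [vt dt] : values t /\ dominant_value iota alpha t.
  by move: tl; rewrite mem_filter => /andP[/asboolP].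
have tlb y : values y -> t <= y.
  move=> vy; have [u [vu du] uy] := values_dominant vy.
  have [le|lt] := lerP u t0; first exact: le_trans (tmin _ (memE _ vu du le)) uy.
  exact: le_trans (tmin _ t0l) (le_trans (ltW lt) uy).
suff -> : metric_mahler R alpha = t by [].
apply/eqP; rewrite eq_le; apply/andP; split.
  by apply: ge_inf => //; exists t => y; exact: tlb.
by apply: lb_le_inf; [exists t|move=> y; exact: tlb].
Qed.

End Attained.

Local Open Scope classical_set_scope.
Local Open Scope complex_scope.

Theorem theorem4p2 (R : realType) (iota : {rmorphism algC -> R[i]})
    (alpha : algC) (halpha : alpha != 0) :
  (metric_mahler R alpha)%:C \in [set iota z | z in galois_closure alpha].
Proof.
have [z [Dz fz _ _]] := metric_mahler_dominant iota halpha.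
by rewrite -Dz inE; exists z => //; exact: in_fixed_galois_closure.
Qed.
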